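(* Let $n,m\in\mathbb{N}$ with $m\ge4$, let $\mathbf{p}=(p_x)_{x\in[m]}$ be a probability mass function on $[m]=\{1,\dots,m\}$ with $p_x>0$ for all $x$, let $X_1,\dots,X_n$ be independent with probability mass function $\mathbf{p}$, and let $Y$ be the number of non-isolated balls, with standard deviation $\sigma_Y>0$. Let $\|\mathbf{p}\|:=\sup_{x\in[m]}p_x$ and $\gamma:=\max(n\|\mathbf{p}\|,1)$. Then $$D_Y\ge\min\left(\tfrac16,\ (8\pi e)^{-1/2}\sigma_Y^{-1}\right).$$ Moreover, if $\|\mathbf{p}\|\le 1/11$ and $$n\ge 83\,\gamma^2(1+3\gamma+3\gamma^2)e^{1.05\gamma},$$ then $$D_Y\le 8165\,\gamma^2e^{2.1\gamma}\left(577+23\,C(\gamma)\right)\sigma_Y^{-1},$$ where $$C(\gamma):=10\left(82\gamma^7+82\gamma^6+80\gamma^5+47\gamma^4+12\gamma^3+12\gamma^2\right)^{1/2}.$$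
   Context: For $1\le i\le n$ let $M_i:=-1+\sum_{j=1}^n\mathbf{1}\{X_j=X_i\}$ (the number of other balls in the same urn as ball $i$). The number of non-isolated balls is $Y:=\sum_{i=1}^n\mathbf{1}\{M_i>0\}$. For a random variable $W$ with finite mean $\mu_W$ and standard deviation $\sigma_W\in(0,\infty)$, $D_W:=\sup_{t\in\mathbb{R}}\left|P\left[\frac{W-\mu_W}{\sigma_W}\le t\right]-\Phi(t)\right|$, where $\Phi$ is the standard normal distribution function. *)

(* Defs.v *)
From HB Require Import structures.
From mathcomp Require Import all_boot all_order all_algebra.
From mathcomp Require Import all_classical all_reals all_analysis.

Set Implicit Arguments.
Unset Strict Implicit.
Unset Printing Implicit Defensive.

Import Order.TTheory GRing.Theory Num.Theory.

Local Open Scope classical_set_scope.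
Local Open Scope ring_scope.

(* Random variables with values in a finite set S with its discrete
   sigma-algebra.  They are not packaged as {RV P >-> S} because measurableType
   includes a distinguished point, which ['I_m] lacks for a variable m. *)
Definition discrete_rv {d} {T : measurableType d} {S : finType}
    (X : T -> S) : Prop :=
  forall A : set S, measurable (X @^-1` A).

Definition mutually_independent {d} {T : measurableType d} {R : realType}
    (P : probability T R) {I S : finType} (X : I -> T -> S) : Prop :=
  forall (J : {set I}) (A : I -> set S),
    P (\bigcap_(i in [set` J]) X i @^-1` A i) =
    (\prod_(i in J) P (X i @^-1` A i))%E.

Definition std_dev {d} {T : measurableType d} {R : realType}
    (P : probability T R) (W : T -> R) : R :=
  Num.sqrt (fine 'V_P[W]).

Definition std_normal_cdf {R : realType} (t : R) : R :=
  fine (normal_prob 0 1 `]-oo, t]).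

(* D_W : Kolmogorov distance between the standardization of W and N(0, 1). *)
Definition normal_distance {d} {T : measurableType d} {R : realType}
    (P : probability T R) (W : T -> R) : R :=
  sup [set `| fine (P [set w | (W w - fine 'E_P[W]) / std_dev P W <= t])
              - std_normal_cdf t | | t in [set: R]].

(* M_i : number of other balls in the same urn as ball i, when x j is the urn
   of ball j. *)
Definition num_companions {n m : nat} (x : 'I_n -> 'I_m) (i : 'I_n) : int :=
  -1 + \sum_(j < n) (x j == x i)%:R.

Definition num_nonisolated {n m : nat} (x : 'I_n -> 'I_m) : nat :=
  (\sum_(i < n) (0 < num_companions x i)%R)%N.

Definition Cgamma {R : realType} (g : R) : R :=
  10 * Num.sqrt (82 * g ^+ 7 + 82 * g ^+ 6 + 80 * g ^+ 5 + 47 * g ^+ 4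
                 + 12 * g ^+ 3 + 12 * g ^+ 2).

(* Main.v *)
(* With X' an independent copy of X and X^{<i} the hybrid whose first coordinates
   come from X', telescoping gives, for functions of independent variables,
     Cov(F, G) = 1/2 sum_i E[(F(X^{<i}) - F(X^{<=i})) (G(X) - G(X^{i}))].
   Taking F = W, the standardization of Y, and G = f(W) yields a Stein identity
   E[W f(W)] = E[f'(W) T] + error, in which T has mean 1 and moving one ball
   changes Y by at most 2; taking F = G yields the Efron-Stein inequality, which
   bounds the fluctuation of T since moving one ball affects only the terms
   sharing an urn with it.  The discontinuity of f' at the target point is
   averaged over consecutive lattice points, which leaves at most half of the
   Kolmogorov distance on the right-hand side.  All error terms are of order
   n^2 (sum_x p_x^2) / sigma^3, and the second and third order terms of the
   Hoeffding decomposition of Y bound sigma^2 from below by a multiple of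
   n^2 (sum_x p_x^2) exp(-2.1 gamma).  The lower bound on D_Y holds because the
   distribution function of W is constant on a lattice gap containing 0. *)
From HB Require Import structures.
From mathcomp Require Import all_boot all_order all_algebra.
From mathcomp Require Import ring lra zify.

Set Implicit Arguments.
Unset Strict Implicit.
Import Order.TTheory GRing.Theory Num.Theory.
Local Open Scope ring_scope.

(** * Expectations over product spaces *)

(** The obstacle is the indicator in the Stein equation. Moving one ball shifts W by up to 2/sigma,
    so the Taylor error of f at a single point s has a jump term weighted by the chance that W lies
    near s, and that chance is controlled only through the Kolmogorov distance D itself. With a =
    n^2 sum_x p_x^2, the resulting coefficient of D at one point is 256 a / sigma^2, where a /
    sigma^2 is known only to be at most K = 29 exp(2.1 gamma): it cannot be absorbed. Over M
    consecutive lattice points the jump windows telescope to a multiple of a single window, so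
    averaging divides this coefficient by M and costs a shift of order M / sigma; M close to 512 K
    brings it down to 1/2. The Taylor errors involve the sum of the absolute values of the terms of
    T, so its fluctuation is bounded together with that of T. Both variances are of order gamma a;
    since T already lives on pairs (X, X'), Efron-Stein is applied to pairs of pairs. The Stein
    argument uses finite sums over an ordered field, with Phi and f known only through inequalities;
    analysis enters when these are verified for the normal law. When sigma < 2 the claimed upper
    bound exceeds 1. *)

Definition is_pmf {R : numDomainType} {S : finType} (p : S -> R) : Prop :=
  (forall s, 0 <= p s) /\ \sum_s p s = 1.

Definition pmf_pair {R : numDomainType} {S : finType} (p : S -> R)
  (s : S * S) : R := p s.1 * p s.2.

Definition Ex {R : numDomainType} {n : nat} {S : finType} (p : S -> R)
  (F : {ffun 'I_n -> S} -> R) : R := \sum_(z : {ffun 'I_n -> S}) (\prod_i p (z i)) * F z.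

Definition upd {n : nat} {S : finType} (z : {ffun 'I_n -> S}) (i : 'I_n)
  (s : S) : {ffun 'I_n -> S} := [ffun j => if j == i then s else z j].

Lemma updE (n : nat) (S : finType) (z : {ffun 'I_n -> S}) i s j :
  upd z i s j = if j == i then s else z j.
Proof. by rewrite ffunE. Qed.

Lemma upd_id (n : nat) (S : finType) (z : {ffun 'I_n -> S}) i :
  upd z i (z i) = z.
Proof. by apply/ffunP => j; rewrite updE; case: eqP => // ->. Qed.

Lemma upd_upd (n : nat) (S : finType) (z : {ffun 'I_n -> S}) i s t :
  upd (upd z i s) i t = upd z i t.
Proof. by apply/ffunP => j; rewrite !updE; case: eqP. Qed.

Section ExTheory.
Variables (R : realFieldType) (n : nat) (S : finType) (p : S -> R).
Implicit Types (F G : {ffun 'I_n -> S} -> R).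

Lemma eq_Ex F G : F =1 G -> Ex p F = Ex p G.
Proof. by move=> FG; apply: eq_bigr => z _; rewrite FG. Qed.

Lemma ExD F G : Ex p (fun z => F z + G z) = Ex p F + Ex p G.
Proof. by rewrite -big_split; apply: eq_bigr => z _; rewrite mulrDr. Qed.

Lemma ExZ c F : Ex p (fun z => c * F z) = c * Ex p F.
Proof. by rewrite mulr_sumr; apply: eq_bigr => z _; rewrite mulrCA. Qed.

Lemma ExB F G : Ex p (fun z => F z - G z) = Ex p F - Ex p G.
Proof.
rewrite -[in RHS](mulN1r (Ex p G)) -ExZ -ExD.
by apply: eq_Ex => z; rewrite mulN1r.
Qed.

Lemma Ex_sum (I : Type) (r : seq I) (P : pred I) (F : I -> {ffun 'I_n -> S} -> R) :
  Ex p (fun z => \sum_(i <- r | P i) F i z) = \sum_(i <- r | P i) Ex p (F i).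
Proof.
rewrite exchange_big /=; apply: eq_bigr => z _.
by rewrite mulr_sumr.
Qed.

Lemma Ex_prod (f : 'I_n -> S -> R) :
  Ex p (fun z : {ffun 'I_n -> S} => \prod_i f i (z i)) = \prod_i \sum_s p s * f i s.
Proof.
rewrite (bigA_distr_bigA (fun i s => p s * f i s)) /=.
by apply: eq_bigr => z _; rewrite big_split.
Qed.

Hypothesis pP : is_pmf p.

Lemma Ex_cst c : Ex p (fun _ : {ffun 'I_n -> S} => c) = c.
Proof.
rewrite /Ex -mulr_suml -(bigA_distr_bigA (fun (_ : 'I_n) s => p s)) /=.
by rewrite big1 ?mul1r // => i _; rewrite pP.2.
Qed.

Lemma Ex_ge0 F : (forall z, 0 <= F z) -> 0 <= Ex p F.
Proof.
move=> F0; apply: sumr_ge0 => z _; apply: mulr_ge0 => //.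
by apply: prodr_ge0 => i _; exact: pP.1.
Qed.

Lemma Ex_le F G : (forall z, F z <= G z) -> Ex p F <= Ex p G.
Proof.
by move=> FG; rewrite -subr_ge0 -ExB; apply: Ex_ge0 => z; rewrite subr_ge0.
Qed.

Lemma Ex_norm F : `|Ex p F| <= Ex p (fun z => `|F z|).
Proof.
rewrite (le_trans (ler_norm_sum _ _ _)) // ler_sum // => z _.
rewrite normrM ger0_norm //.
by apply: prodr_ge0 => i _; exact: pP.1.
Qed.

(** Exchanging coordinate [i] with an independent draw is a weight-preserving involution on
    configurations paired with one extra draw. *)
Lemma Ex_resample F i :
  Ex p F = Ex p (fun z => \sum_s p s * F (upd z i s)).
Proof.
transitivity (\sum_(u : {ffun 'I_n -> S} * S)
    (\prod_j p (u.1 j)) * p u.2 * F u.1).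
  rewrite -(pair_bigA _ (fun (z : {ffun 'I_n -> S}) s => (\prod_j p (z j)) * p s * F z)) /=.
  apply: eq_bigr => z _; rewrite -[LHS]mul1r -pP.2 mulr_suml.
  by apply: eq_bigr => s _; rewrite mulrCA mulrA.
pose h (u : {ffun 'I_n -> S} * S) := (upd u.1 i u.2, u.1 i).
have hK : involutive h.
  by move=> [z s]; rewrite /h /= upd_upd upd_id updE eqxx.
rewrite (reindex h) /=; last by exists h => u _; exact: hK.
rewrite -(pair_bigA _ (fun (z : {ffun 'I_n -> S}) s => (\prod_j p (upd z i s j)) * p (z i)
  * F (upd z i s))) /=.
apply: eq_bigr => z _; rewrite mulr_sumr; apply: eq_bigr => s _.
rewrite mulrA; congr (_ * _).
rewrite (bigD1 i) //= [in RHS](bigD1 i) //= updE eqxx.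
rewrite (eq_bigr (fun j => p (z j))); first by ring.
by move=> j /negbTE ji; rewrite updE ji.
Qed.

Lemma Ex_coord (f : S -> R) i :
  Ex p (fun z : {ffun 'I_n -> S} => f (z i)) = \sum_s p s * f s.
Proof.
rewrite (Ex_resample _ i) -[RHS]Ex_cst; apply: eq_Ex => z.
by apply: eq_bigr => s _; rewrite updE eqxx.
Qed.

Lemma Ex_sqr_dev F :
  Ex p (fun z => (F z - Ex p F) ^+ 2) = Ex p (fun z => F z ^+ 2) - Ex p F ^+ 2.
Proof.
have [m Em] : exists m, m = Ex p F by exists (Ex p F).
rewrite -Em.
transitivity (Ex p (fun z => F z ^+ 2) - 2 * m * Ex p F + m ^+ 2).
  by rewrite -ExZ -[m ^+ 2 in RHS]Ex_cst -ExB -ExD; apply: eq_Ex => z; ring.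
by rewrite -Em; ring.
Qed.

Lemma Ex_CauchySchwarz F G :
  (Ex p (fun z => F z * G z)) ^+ 2
    <= Ex p (fun z => F z ^+ 2) * Ex p (fun z => G z ^+ 2).
Proof.
set a := Ex p (fun z => F z ^+ 2); set b := Ex p (fun z => G z ^+ 2).
set c := Ex p _.
have quad t : 0 <= a * t ^+ 2 - 2 * t * c + b.
  suff -> : a * t ^+ 2 - 2 * t * c + b = Ex p (fun z => (t * F z - G z) ^+ 2).
    by apply: Ex_ge0 => z; exact: sqr_ge0.
  rewrite [a * _]mulrC -!ExZ -ExB -ExD; apply: eq_Ex => z; ring.
have [a0|a0] := eqVneq a 0.
  have [->|c0] := eqVneq c 0; first by rewrite a0 expr0n mul0r.
  (* With a = 0 the quadratic is affine in t, and this t gives it the value -1. *)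
  have := quad ((b + 1) / (2 * c)); rewrite a0 mul0r sub0r.
  have -> : - (2 * ((b + 1) / (2 * c)) * c) + b = -1 by field.
  by rewrite ler0N1.
have a_gt0 : 0 < a.
  by rewrite lt_def a0 /=; apply: Ex_ge0 => z; exact: sqr_ge0.
have := quad (c / a).
have -> : a * (c / a) ^+ 2 - 2 * (c / a) * c + b = (a * b - c ^+ 2) / a.
  by field.
by rewrite pmulr_lge0 ?invr_gt0 // subr_ge0.
Qed.

End ExTheory.

Lemma pmf_pairP (R : realFieldType) (S : finType) (p : S -> R) :
  is_pmf p -> is_pmf (pmf_pair p).
Proof.
move=> [p0 p1]; split=> [s|]; first exact: mulr_ge0.
rewrite -(pair_bigA _ (fun a b => p a * p b)) /=.
under eq_bigr do rewrite -mulr_sumr p1 mulr1.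
exact: p1.
Qed.

(** * Two independent copies and their hybrids *)

Section Doubling.
Variables (R : realFieldType) (n : nat) (S : finType) (p : S -> R).
Hypothesis pP : is_pmf p.
Implicit Types (z : {ffun 'I_n -> S * S}).

(* A point z encodes the pair (X, X'): hyb k z is X^{<k}, so that hyb 0 z is X
   and hyb n z is X', and one i z is X^{i}. *)
Definition mixA (A : pred 'I_n) z : {ffun 'I_n -> S} :=
  [ffun i => if A i then (z i).2 else (z i).1].

Definition hyb (k : nat) z := mixA (fun i => (i < k)%N) z.
Definition one (i : 'I_n) z := mixA (pred1 i) z.
Definition swapA (A : pred 'I_n) z : {ffun 'I_n -> S * S} :=
  [ffun i => if A i then ((z i).2, (z i).1) else z i].

Local Notation Ex2 := (Ex (pmf_pair p)).

(** X and X' may be exchanged on any set of coordinates without changing their joint law; all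
    transfers between hybrids rest on this. *)
Lemma Ex_swap A (F : {ffun 'I_n -> S * S} -> R) :
  Ex2 F = Ex2 (fun z => F (swapA A z)).
Proof.
have swK : involutive (swapA A).
  move=> z; apply/ffunP => i; rewrite !ffunE; case: (A i) => //=.
  by rewrite -surjective_pairing.
rewrite /Ex (reindex (swapA A)) /=; last by exists (swapA A) => z _; exact: swK.
apply: eq_bigr => z _; congr (_ * _); apply: eq_bigr => i _.
by rewrite ffunE; case: (A i) => //; rewrite /pmf_pair /= mulrC.
Qed.

Lemma Ex2_indep (F G : {ffun 'I_n -> S} -> R) :
  Ex2 (fun z => F (hyb 0 z) * G (hyb n z)) = Ex p F * Ex p G.
Proof.
rewrite /Ex big_distrl /=.
under [RHS]eq_bigr do rewrite big_distrr /=.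
rewrite pair_bigA /=.
pose h z := (hyb 0 z, hyb n z).
pose h' (u : {ffun 'I_n -> S} * {ffun 'I_n -> S}) : {ffun 'I_n -> S * S} :=
  [ffun i => (u.1 i, u.2 i)].
rewrite [RHS](reindex h) /=; last first.
  exists h' => [z|[x y]] _.
    by apply/ffunP => i; rewrite !ffunE /= ltn_ord -surjective_pairing.
  by congr pair; apply/ffunP => i; rewrite !ffunE /= ?ltn_ord.
apply: eq_bigr => z _.
under [in LHS]eq_bigr do rewrite /pmf_pair.
rewrite big_split /= mulrACA; congr (_ * _ * (_ * _)).
  by apply: eq_bigr => i _; rewrite ffunE.
by apply: eq_bigr => i _; rewrite ffunE ltn_ord.
Qed.

Lemma Ex2_fst (F : {ffun 'I_n -> S} -> R) :
  Ex2 (fun z => F (hyb 0 z)) = Ex p F.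
Proof.
rewrite -[RHS]mulr1 -(Ex_cst n pP 1) -Ex2_indep.
by apply: eq_Ex => z; rewrite mulr1.
Qed.

Lemma hyb_swap k z : hyb 0 (swapA (fun i => (i < k)%N) z) = hyb k z.
Proof. by apply/ffunP => i; rewrite !ffunE ltn0; case: ifP. Qed.

Lemma hyb_swap1 (i : 'I_n) z : hyb i (swapA (pred1 i) z) = hyb i.+1 z.
Proof.
apply/ffunP => j; rewrite !ffunE /= -[j == i]val_eqE /= ltnS.
by case: (ltngtP j i).
Qed.

Lemma hybS_swap1 (i : 'I_n) z : hyb i.+1 (swapA (pred1 i) z) = hyb i z.
Proof.
apply/ffunP => j; rewrite !ffunE /= -[j == i]val_eqE /= ltnS.
by case: (ltngtP j i).
Qed.

Lemma hyb0_swap1 (i : 'I_n) z : hyb 0 (swapA (pred1 i) z) = one i z.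
Proof. by apply/ffunP => j; rewrite !ffunE /=; case: eqP. Qed.

Lemma one_swap (i : 'I_n) z :
  one i (swapA (fun j => (j < i)%N) z) = hyb i.+1 z.
Proof.
apply/ffunP => j; rewrite !ffunE /= -[j == i]val_eqE /= ltnS.
by case: (ltngtP j i).
Qed.

Lemma hyb_self (i : 'I_n) z : hyb i z i = (z i).1.
Proof. by rewrite ffunE ltnn. Qed.

Lemma hybS_self (i : 'I_n) z : hyb i.+1 z i = (z i).2.
Proof. by rewrite ffunE ltnSn. Qed.

Lemma one_self (i : 'I_n) z : one i z i = (z i).2.
Proof. by rewrite ffunE /= eqxx. Qed.

Lemma hyb0E z j : hyb 0 z j = (z j).1.
Proof. by rewrite ffunE. Qed.

Lemma hybS_off (i : 'I_n) z j : j != i -> hyb i z j = hyb i.+1 z j.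
Proof.
rewrite !ffunE ltnS -val_eqE /= => ji.
by rewrite (leq_eqVlt j) (negbTE ji).
Qed.

Lemma one_off (i : 'I_n) z j : j != i -> hyb 0 z j = one i z j.
Proof. by rewrite !ffunE /= => /negbTE ->. Qed.

(* Telescoping F(fst) - F(snd) along the hybrids, then exchanging the two
   copies of the i-th coordinate. *)
Lemma covariance_identity (F G : {ffun 'I_n -> S} -> R) :
  Ex p (fun x => F x * G x) - Ex p F * Ex p G =
  2^-1 * \sum_(i < n) Ex2 (fun z => (F (hyb i z) - F (hyb i.+1 z)) *
                              (G (hyb 0 z) - G (one i z))).
Proof.
have -> : Ex p (fun x => F x * G x) - Ex p F * Ex p G =
    Ex2 (fun z => (F (hyb 0 z) - F (hyb n z)) * G (hyb 0 z)).
  rewrite -(Ex2_fst (fun x => F x * G x)) [Ex p F * _]mulrC -Ex2_indep -ExB.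
  by apply: eq_Ex => z; ring.
have -> : Ex2 (fun z => (F (hyb 0 z) - F (hyb n z)) * G (hyb 0 z)) =
    \sum_(i < n) Ex2 (fun z => (F (hyb i z) - F (hyb i.+1 z)) * G (hyb 0 z)).
  rewrite -Ex_sum; apply: eq_Ex => z; rewrite -mulr_suml; congr (_ * _).
  rewrite -(big_mkord xpredT (fun i => F (hyb i z) - F (hyb i.+1 z))).
  rewrite -opprB -(telescope_sumr (fun k => F (hyb k z)) (leq0n n)) -sumrN.
  by apply: eq_bigr => i _; rewrite opprB.
rewrite mulr_sumr; apply: eq_bigr => i _; set a := LHS.
have aE : a = Ex2 (fun z => (F (hyb i.+1 z) - F (hyb i z)) * G (one i z)).
  rewrite /a (Ex_swap (pred1 i)); apply: eq_Ex => z.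
  by rewrite hyb_swap1 hybS_swap1 hyb0_swap1.
have -> : a = 2^-1 * (a + a) by field.
rewrite {2}aE /a -ExD; congr (_ * _); apply: eq_Ex => z; ring.
Qed.

(** For F = G each term of the covariance identity is the mean of a product of two increments, at
    most half the sum of their squares. The two squares have the same mean: swapping the coordinates
    before [i] turns one increment into the other. *)
Lemma Efron_Stein (F : {ffun 'I_n -> S} -> R) :
  Ex p (fun x => F x ^+ 2) - Ex p F ^+ 2 <=
  2^-1 * \sum_(i < n) Ex2 (fun z => (F (hyb 0 z) - F (one i z)) ^+ 2).
Proof.
have -> : Ex p (fun x => F x ^+ 2) - Ex p F ^+ 2 =
          Ex p (fun x => F x * F x) - Ex p F * Ex p F by [].
rewrite covariance_identity ler_pM2l ?invr_gt0 // ler_sum // => i _.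
set b := leRHS.
have bE : b = Ex2 (fun z => (F (hyb i z) - F (hyb i.+1 z)) ^+ 2).
  rewrite /b (Ex_swap (fun j => (j < i)%N)); apply: eq_Ex => z.
  by rewrite hyb_swap one_swap.
have -> : b = 2^-1 * (b + b) by field.
rewrite {1}bE /b -ExD -ExZ; apply: Ex_le; first exact: pmf_pairP.
move=> z; have := sqr_ge0 ((F (hyb i z) - F (hyb i.+1 z))
                          - (F (hyb 0 z) - F (one i z))); nra.
Qed.

End Doubling.

(** * Local dependence of the number of non-isolated balls *)

Section Coincidences.
Variables (R : realFieldType) (n : nat) (S : finType) (p : S -> R).
Hypothesis pP : is_pmf p.
Variables (d : S -> S -> R) (B M s : R).
Hypotheses (d_ge0 : forall a b, 0 <= d a b) (d_le : forall a b, d a b <= B).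
Hypothesis (mean_le : forall b, \sum_a p a * d a b <= M).
Hypothesis (mean2 : \sum_b p b * (\sum_a p a * d a b) = s).

Lemma Ex_pair_coord (i k : 'I_n) : i != k ->
  Ex p (fun z : {ffun 'I_n -> S} => d (z i) (z k)) = s.
Proof.
move=> ik; rewrite (Ex_resample pP _ i) -mean2.
rewrite -(Ex_coord pP (fun b => \sum_a p a * d a b) k).
apply: eq_Ex => z; apply: eq_bigr => a _.
by rewrite !updE eqxx eq_sym (negbTE ik).
Qed.

(** Expand the square. On the diagonal d^2 <= B d; for distinct i, j, averaging over ball j first
    costs a factor M and leaves the mean s of one pair. *)
Lemma Ex_sqr_pairs (k : 'I_n) :
  Ex p (fun z : {ffun 'I_n -> S} => (\sum_(i | i != k) d (z i) (z k)) ^+ 2)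
    <= n%:R * (B * s) + n%:R ^+ 2 * (M * s).
Proof.
have sE : s = Ex p (fun z : {ffun 'I_n -> S} => \sum_a p a * d a (z k)).
  by rewrite -mean2 (Ex_coord pP (fun b => \sum_a p a * d a b) k).
have s_ge0 : 0 <= s.
  rewrite sE; apply: (Ex_ge0 pP) => z; apply: sumr_ge0 => a _.
  by apply: mulr_ge0 => //; exact: pP.1.
have B_ge0 : 0 <= B.
  have [a _|S0] := pickP (predT : pred S); first exact: le_trans (d_le a a).
  by have := pP.2; rewrite big1 => [/eqP|a]; [rewrite eq_sym oner_eq0|have := S0 a].
have M_ge0 : 0 <= M.
  have [a _|S0] := pickP (predT : pred S).
    apply: le_trans (mean_le a); apply: sumr_ge0 => b _.
    by apply: mulr_ge0 => //; exact: pP.1.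
  by have := pP.2; rewrite big1 => [/eqP|a]; [rewrite eq_sym oner_eq0|have := S0 a].
rewrite (eq_Ex _ (G := fun z => \sum_(i | i != k) \sum_(j | j != k)
    d (z i) (z k) * d (z j) (z k))); last first.
  by move=> z; rewrite expr2 mulr_suml; apply: eq_bigr => i _; rewrite mulr_sumr.
rewrite Ex_sum.
have term (i : 'I_n) : i != k -> Ex p (fun z : {ffun 'I_n -> S} => \sum_(j | j != k)
    d (z i) (z k) * d (z j) (z k)) <= B * s + n%:R * (M * s).
  move=> ik; rewrite Ex_sum (bigD1 i) //=; apply: lerD.
    rewrite -(Ex_pair_coord ik) -ExZ; apply: (Ex_le pP) => z.
    by rewrite ler_wpM2r.
  apply: (@le_trans _ _ (\sum_(j < n) M * s)); last first.
    by rewrite sumr_const card_ord mulr_natl.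
  rewrite big_mkcond /=; apply: ler_sum => j _.
  case: ifP => [/andP[jk ji]|_]; last exact: mulr_ge0.
  rewrite (Ex_resample pP _ j) -(Ex_pair_coord ik) -ExZ.
  apply: (Ex_le pP) => z.
  under eq_bigr do rewrite !updE eqxx (eq_sym i) (negbTE ji) (eq_sym k) (negbTE jk)
    mulrCA.
  by rewrite -mulr_sumr mulrC ler_wpM2r.
apply: (@le_trans _ _ (\sum_(i < n) (B * s + n%:R * (M * s)))).
  rewrite big_mkcond; apply: ler_sum => i _; case: ifP => [|_]; first exact: term.
  by rewrite addr_ge0 ?mulr_ge0.
rewrite sumr_const card_ord -[leLHS]mulr_natl le_eqVlt; apply/orP; left.
by apply/eqP; ring.
Qed.

End Coincidences.

Section Urn.
Variables (R : realFieldType) (n : nat) (S : finType).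
Implicit Types (x y : {ffun 'I_n -> S}) (z : {ffun 'I_n -> S * S}).

Definition cnt (i : 'I_n) (a : S) x : nat := (\sum_(j | j != i) (x j == a))%N.

Definition nonisolated x : R := \sum_i (0 < cnt i (x i) x)%N%:R.

(* The number of balls that stop being isolated when a ball joins an urn
   containing k others. *)
Definition gain (k : nat) : R := (0 < k)%N%:R + (k == 1)%N%:R.

Lemma gain_bounds k : 0 <= gain k <= 2.
Proof. by rewrite /gain; case: k => [|[|k]] /=; apply/andP; split; lra. Qed.

Lemma gain_le k : gain k <= 2 * k%:R.
Proof.
rewrite /gain; case: k => [|[|k]] /=; [lra|lra|].
have : (0 : R) <= k%:R by []. 
rewrite -[k.+2]addn2 natrD; lra.
Qed.

Lemma eq_cnt i a x y : (forall j, j != i -> x j = y j) -> cnt i a x = cnt i a y.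
Proof. by move=> xy; apply: eq_bigr => j /xy ->. Qed.

(** This is the number of non-isolated balls after ball [i] has been removed, hence independent of
    [x i]. *)
Definition base (i : 'I_n) x : R :=
  \sum_(j | j != i) (0 < \sum_(l | (l != j) && (l != i)) (x l == x j))%N%:R.

Lemma nonisolatedE i x : nonisolated x = base i x + gain (cnt i (x i) x).
Proof.
rewrite /nonisolated (bigD1 i) //= addrC /gain addrA [RHS]addrAC; congr (_ + _).
rewrite /base.
(* If ball i has exactly one companion, the indicator is charged to that companion; both sides then
   become sums over j and can be compared ball by ball. *)
have -> : (cnt i (x i) x == 1%N)%:R =
    \sum_(j | j != i) ((x j == x i) && (cnt i (x i) x == 1%N))%:R :> R.
  have [E|_] := boolP (cnt i (x i) x == 1%N); last first.
    by rewrite big1 // => j _; rewrite andbF.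
  under eq_bigr do rewrite andbT.
  by rewrite -natr_sum -/(cnt i (x i) x) (eqP E).
rewrite -big_split /=; apply: eq_bigr => j ji.
rewrite {1}/cnt (bigD1 i) 1?eq_sym //= eq_sym.
have [xij|_] := eqVneq (x j) (x i); last by rewrite add0n addr0.
rewrite /cnt [X in _ + (_ && (X == _))%:R](bigD1 j) //= xij eqxx.
rewrite [X in ((_ + X)%N == _)](eq_bigl (fun l => (l != j) && (l != i))); last first.
  by move=> l; rewrite andbC.
by case: (\sum_(_ < n | _) _)%N => [|c] /=; rewrite ?addr0 ?add0r.
Qed.

Lemma nonisolated_diff i x y : (forall j, j != i -> x j = y j) ->
  nonisolated x - nonisolated y = gain (cnt i (x i) x) - gain (cnt i (y i) x).
Proof.
move=> xy; rewrite (nonisolatedE i x) (nonisolatedE i y) -(eq_cnt _ xy).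
have -> : base i x = base i y.
  rewrite /base; apply: eq_bigr => j ji; congr (_ %:R); congr (nat_of_bool (0 < _)%N).
  by apply: eq_bigr => l /andP[_ li]; rewrite !xy.
ring.
Qed.

Lemma nonisolated_diff_le i x y : (forall j, j != i -> x j = y j) ->
  `|nonisolated x - nonisolated y| <= 2.
Proof.
move=> /nonisolated_diff ->; have := gain_bounds (cnt i (x i) x).
have := gain_bounds (cnt i (y i) x); rewrite ler_norml; lra.
Qed.

(** Both increments move ball [i] from [(z i).1] to [(z i).2]; the other balls are in the hybrid
    state for [incr1] and all in X for [incr2]. Their product is the summand of the covariance
    identity for Y with itself. *)
Definition incr1 (i : 'I_n) z : R := nonisolated (hyb i z) - nonisolated (hyb i.+1 z).
Definition incr2 (i : 'I_n) z : R := nonisolated (hyb 0 z) - nonisolated (one i z).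

Lemma incr1E i z : incr1 i z =
  gain (cnt i (z i).1 (hyb i z)) - gain (cnt i (z i).2 (hyb i z)).
Proof.
rewrite /incr1 (nonisolated_diff (i := i)); last exact: hybS_off.
by rewrite hyb_self hybS_self.
Qed.

Lemma incr2E i z : incr2 i z =
  gain (cnt i (z i).1 (hyb 0 z)) - gain (cnt i (z i).2 (hyb 0 z)).
Proof.
rewrite /incr2 (nonisolated_diff (i := i)); last exact: one_off.
by rewrite hyb0E one_self.
Qed.

Lemma incr1_le i z : `|incr1 i z| <= 2.
Proof. by apply: (nonisolated_diff_le (i := i)); exact: hybS_off. Qed.

Lemma incr2_le i z : `|incr2 i z| <= 2.
Proof. by apply: (nonisolated_diff_le (i := i)); exact: one_off. Qed.

(** All four comparisons are needed because a hybrid may use either copy of either ball. The values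
    are natural numbers, so a value below 1 means that no urn is shared. *)
Definition coinc (a b : S * S) : R :=
  (a.1 == b.1)%:R + (a.1 == b.2)%:R + (a.2 == b.1)%:R + (a.2 == b.2)%:R.

Lemma coinc_ge0 a b : 0 <= coinc a b.
Proof. by rewrite !addr_ge0. Qed.

Lemma coinc_le a b : coinc a b <= 4.
Proof.
have le1 (c : bool) : c%:R <= 1 :> R by case: c.
rewrite /coinc; have := (le1 (a.1 == b.1), le1 (a.1 == b.2)).
have := (le1 (a.2 == b.1), le1 (a.2 == b.2)).
by move=> [? ?] [? ?]; lra.
Qed.

Lemma coinc_lt1 a b : coinc a b < 1 ->
  [/\ a.1 != b.1, a.1 != b.2, a.2 != b.1 & a.2 != b.2].
Proof.
rewrite /coinc; case: eqP => _; case: eqP => _; case: eqP => _; case: eqP => _ //=;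
  lra.
Qed.

Lemma incr2_coinc i z : `|incr2 i z| <= 2 * \sum_(j | j != i) coinc (z j) (z i).
Proof.
rewrite incr2E; set a := cnt _ _ _; set b := cnt i (z i).2 _.
have ab : (a + b)%:R <= \sum_(j | j != i) coinc (z j) (z i).
  rewrite /a /b /cnt -big_split /= natr_sum; apply: ler_sum => j _.
  rewrite natrD hyb0E /coinc.
  have : 0 <= ((z j).2 == (z i).1)%:R :> R by [].
  have : 0 <= ((z j).2 == (z i).2)%:R :> R by [].
  lra.
have := gain_le a; have := gain_le b; have := gain_bounds a; have := gain_bounds b.
move: ab; rewrite natrD ler_norml => *; lra.
Qed.

Lemma incr_prod_coinc i z :
  `|incr1 i z * incr2 i z| <= 4 * \sum_(j | j != i) coinc (z j) (z i).
Proof.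
rewrite normrM (_ : 4 = 2 * 2); last by ring.
by rewrite -mulrA ler_pM // ?incr1_le ?incr2_coinc.
Qed.

Lemma eq_cnt_update (k i : 'I_n) a x y : i != k ->
  (forall j, j != k -> x j = y j) -> x k != a -> y k != a ->
  cnt i a x = cnt i a y.
Proof.
move=> ik xy xa ya; apply: eq_bigr => j _.
by have [->|/xy ->//] := eqVneq j k; rewrite (negbTE xa) (negbTE ya).
Qed.

(** The increments of ball i depend only on the occupancy of its two urns. Ball k, before and after
    its change and in whichever copy the hybrid selects, lies in neither. *)
Lemma incr_prod_local (k i : 'I_n) z z' : i != k ->
  (forall j, j != k -> z j = z' j) ->
  coinc (z i) (z k) < 1 -> coinc (z i) (z' k) < 1 ->
  incr1 i z * incr2 i z = incr1 i z' * incr2 i z'.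
Proof.
move=> ik zz' /coinc_lt1[h1 h2 h3 h4] /coinc_lt1[h5 h6 h7 h8].
rewrite !incr1E !incr2E -(zz' _ ik).
have E a l : (z k).1 != a -> (z k).2 != a -> (z' k).1 != a -> (z' k).2 != a ->
    cnt i a (hyb l z) = cnt i a (hyb l z').
  move=> ? ? ? ?; apply: (eq_cnt_update ik).
  - by move=> j jk; rewrite !ffunE zz'.
  - by rewrite ffunE; case: ifP.
  - by rewrite ffunE; case: ifP.
by rewrite !(E (z i).1, E (z i).2) // eq_sym.
Qed.

Section Psi.
Variable psi : R -> R.
Hypothesis psi_lip : forall a b, `|psi a - psi b| <= `|a - b|.

(** [psi] is left open because two 1-Lipschitz choices are needed: the identity gives T up to the
    factor 2 sigma^2, the absolute value gives the sum that dominates the Taylor remainders. *)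
Definition qsum z : R := \sum_i psi (incr1 i z * incr2 i z).

(** The constant is 4 + 8: term k is bounded by 4 times its coincidences before and after the
    change; any other term is unchanged unless it coincides with ball k, and then changes by at most
    4 + 4. *)
Lemma qsum_diff (k : 'I_n) z z' : (forall j, j != k -> z j = z' j) ->
  `|qsum z - qsum z'| <=
  12 * \sum_(i | i != k) (coinc (z i) (z k) + coinc (z i) (z' k)).
Proof.
move=> zz'; rewrite /qsum (bigD1 k) //= [X in _ - X](bigD1 k) //=.
rewrite opprD addrACA -sumrB.
have -> : 12 = 4 + 8 :> R by ring.
rewrite [leRHS]mulrDl; apply: (le_trans (ler_normD _ _)); apply: lerD.
  apply: (le_trans (psi_lip _ _)); apply: (le_trans (ler_normB _ _)).
  rewrite big_split [leRHS]mulrDr; apply: lerD; first exact: incr_prod_coinc.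
  rewrite (eq_bigr (fun i => coinc (z' i) (z' k))) ?incr_prod_coinc //.
  by move=> i /zz' ->.
apply: (le_trans (ler_norm_sum _ _ _)).
rewrite mulr_sumr; apply: ler_sum => i ik.
apply: (le_trans (psi_lip _ _)).
have c1 := coinc_ge0 (z i) (z k); have c2 := coinc_ge0 (z i) (z' k).
have [l1|l1] := ltP (coinc (z i) (z k)) 1; last first.
  have b (u : {ffun 'I_n -> S * S}) : `|incr1 i u * incr2 i u| <= 4.
    rewrite normrM (_ : 4 = 2 * 2); last by ring.
    by rewrite ler_pM // ?incr1_le ?incr2_le.
  have := ler_normB (incr1 i z * incr2 i z) (incr1 i z' * incr2 i z').
  have := b z; have := b z'; lra.
have [l2|l2] := ltP (coinc (z i) (z' k)) 1; last first.
  have b (u : {ffun 'I_n -> S * S}) : `|incr1 i u * incr2 i u| <= 4.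
    rewrite normrM (_ : 4 = 2 * 2); last by ring.
    by rewrite ler_pM // ?incr1_le ?incr2_le.
  have := ler_normB (incr1 i z * incr2 i z) (incr1 i z' * incr2 i z').
  have := b z; have := b z'; lra.
rewrite (incr_prod_local ik zz') // subrr normr0; lra.
Qed.

End Psi.

Variable p : S -> R.
Hypothesis pP : is_pmf p.
Variable pmax : R.
Hypothesis p_le : forall a, p a <= pmax.
Let s2 : R := \sum_a p a ^+ 2.

Lemma sum_pmf_eq (a : S) : \sum_b p b * (b == a)%:R = p a.
Proof.
rewrite (bigD1 a) //= eqxx mulr1 big1 ?addr0 // => b /negbTE ->.
by rewrite mulr0.
Qed.

Lemma pair_sum_fst (f : S -> R) :
  \sum_a pmf_pair p a * f a.1 = \sum_b p b * f b.
Proof.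
rewrite -(pair_bigA _ (fun a b => (p a * p b) * f a)) /=.
apply: eq_bigr => a _; under eq_bigr do rewrite -mulrA mulrCA.
by rewrite -mulr_suml pP.2 mul1r.
Qed.

Lemma pair_sum_snd (f : S -> R) :
  \sum_a pmf_pair p a * f a.2 = \sum_b p b * f b.
Proof.
rewrite -(pair_bigA _ (fun a b => (p a * p b) * f b)) /=.
rewrite exchange_big; apply: eq_bigr => a _ /=.
under eq_bigr do rewrite -mulrA.
by rewrite -mulr_suml pP.2 mul1r.
Qed.

Lemma mean_coinc (b : S * S) :
  \sum_a pmf_pair p a * coinc a b = 2 * (p b.1 + p b.2).
Proof.
under eq_bigr do rewrite /coinc !mulrDr.
rewrite !big_split /= (pair_sum_fst (fun u => (u == b.1)%:R)).
rewrite (pair_sum_fst (fun u => (u == b.2)%:R)).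
rewrite (pair_sum_snd (fun u => (u == b.1)%:R)).
rewrite (pair_sum_snd (fun u => (u == b.2)%:R)) !sum_pmf_eq; ring.
Qed.

Lemma mean_mean_coinc :
  \sum_b pmf_pair p b * (\sum_a pmf_pair p a * coinc a b) = 4 * s2.
Proof.
under eq_bigr do rewrite mean_coinc mulrCA mulrDr.
rewrite -mulr_sumr big_split /= pair_sum_fst pair_sum_snd /s2.
under eq_bigr do rewrite -expr2.
ring.
Qed.

Lemma Ex_incr_prod_abs :
  Ex (pmf_pair p) (qsum (fun t => `|t|)) <= 16 * (n%:R ^+ 2 * s2).
Proof.
have s2_ge0 : 0 <= s2 by apply: sumr_ge0 => a _; exact: sqr_ge0.
rewrite /qsum Ex_sum.
apply: (@le_trans _ _ (\sum_(i < n) 16 * (n%:R * s2))); last first.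
  by rewrite sumr_const card_ord -mulr_natl le_eqVlt; apply/orP; left; apply/eqP; ring.
apply: ler_sum => i _.
apply: (@le_trans _ _ (Ex (pmf_pair p) (fun z : {ffun 'I_n -> S * S} =>
   4 * \sum_(j | j != i) coinc (z j) (z i)))).
  by apply: (Ex_le (pmf_pairP pP)) => z; exact: incr_prod_coinc.
rewrite ExZ Ex_sum.
have -> : 16 * (n%:R * s2) = 4 * (\sum_(j < n) 4 * s2).
  by rewrite sumr_const card_ord -mulr_natl; ring.
rewrite ler_pM2l // big_mkcond /=; apply: ler_sum => j _.
case: ifP => [ji|_]; last by rewrite mulr_ge0.
by rewrite (Ex_pair_coord (pmf_pairP pP) mean_mean_coinc).
Qed.

(** Efron-Stein for functions of pairs, followed by the second moment of a sum of coincidences with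
    B = 8, M = 8 [pmax], s = 8 [s2]. The constant is 1/2 * 12^2 * 64. *)
Lemma Var_qsum (psi : R -> R) : 
  (forall a b, `|psi a - psi b| <= `|a - b|) ->
  Ex (pmf_pair p) (fun z => qsum psi z ^+ 2) - Ex (pmf_pair p) (qsum psi) ^+ 2
  <= 4608 * (n%:R ^+ 2 * s2 * (1 + n%:R * pmax)).
Proof.
move=> psi_lip.
apply: (le_trans (Efron_Stein (pmf_pairP pP) _)).
(* Ball k is the one being moved, so both of its states [b.1] and [b.2] count, while the other balls
   stay in the state [a.1]. *)
pose d (a b : (S * S) * (S * S)) : R := coinc a.1 b.1 + coinc a.1 b.2.
have pP2 := pmf_pairP pP; have pP4 := pmf_pairP pP2.
have d_ge0 a b : 0 <= d a b by rewrite addr_ge0 ?coinc_ge0.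
have d_le a b : d a b <= 8.
  have := coinc_le a.1 b.1; have := coinc_le a.1 b.2; rewrite /d; lra.
have m1 b : \sum_a pmf_pair (pmf_pair p) a * d a b =
   2 * (p b.1.1 + p b.1.2) + 2 * (p b.2.1 + p b.2.2).
  rewrite -!mean_coinc -big_split /=.
  rewrite -(pair_bigA _ (fun a a' => pmf_pair p a * pmf_pair p a' *
     (coinc a b.1 + coinc a b.2))) /=.
  apply: eq_bigr => a _; under eq_bigr do rewrite -mulrA mulrCA.
  by rewrite -mulr_suml pP2.2 mul1r mulrDr.
have mean_le b : \sum_a pmf_pair (pmf_pair p) a * d a b <= 8 * pmax.
  rewrite m1; have := p_le b.1.1; have := p_le b.1.2; have := p_le b.2.1.
  have := p_le b.2.2; lra.
have mean2 : \sum_b pmf_pair (pmf_pair p) b *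
    (\sum_a pmf_pair (pmf_pair p) a * d a b) = 8 * s2.
  under eq_bigr do rewrite m1 mulrDr -!mean_coinc.
  rewrite big_split /=.
  have -> : \sum_i pmf_pair (pmf_pair p) i * (\sum_a pmf_pair p a * coinc a i.1)
      = 4 * s2.
    rewrite -mean_mean_coinc.
    rewrite -(pair_bigA _ (fun a a' => pmf_pair p a * pmf_pair p a' *
       (\sum_c pmf_pair p c * coinc c a))) /=.
    apply: eq_bigr => a _; under eq_bigr do rewrite -mulrA mulrCA.
    by rewrite -mulr_suml pP2.2 mul1r.
  have -> : \sum_i pmf_pair (pmf_pair p) i * (\sum_a pmf_pair p a * coinc a i.2)
      = 4 * s2.
    rewrite -mean_mean_coinc.
    rewrite -(pair_bigA _ (fun a a' => pmf_pair p a * pmf_pair p a' *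
       (\sum_c pmf_pair p c * coinc c a'))) /=.
    rewrite exchange_big /=.
    apply: eq_bigr => a _; under eq_bigr do rewrite -mulrA.
    by rewrite -mulr_suml pP2.2 mul1r.
  ring.
have bnd (k : 'I_n) : Ex (pmf_pair (pmf_pair p)) (fun w =>
    (qsum psi (hyb 0 w) - qsum psi (one k w)) ^+ 2) <=
    144 * (n%:R * (8 * (8 * s2)) + n%:R ^+ 2 * (8 * pmax * (8 * s2))).
  apply: (@le_trans _ _ (Ex (pmf_pair (pmf_pair p))
    (fun w : {ffun 'I_n -> (S * S) * (S * S)} =>
      144 * (\sum_(i | i != k) d (w i) (w k)) ^+ 2))).
    apply: (Ex_le pP4) => w.
    have := qsum_diff psi_lip (@one_off _ _ k w).
    rewrite (eq_bigr (fun i => d (w i) (w k))); last first.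
      by move=> i ik; rewrite /d !hyb0E one_self.
    set D := \sum_(i | _) _; set q := _ - _ => qD.
    have D0 : 0 <= D by apply: sumr_ge0.
    rewrite -[leLHS]real_normK ?num_real // (_ : 144 * D ^+ 2 = (12 * D) ^+ 2).
      by rewrite lerXn2r ?nnegrE ?mulr_ge0.
    by ring.
  rewrite ExZ ler_pM2l //.
  exact: (Ex_sqr_pairs pP4 d_ge0 d_le mean_le mean2).
apply: (@le_trans _ _ (2^-1 * \sum_(k < n)
    144 * (n%:R * (8 * (8 * s2)) + n%:R ^+ 2 * (8 * pmax * (8 * s2))))).
  by rewrite ler_pM2l ?invr_gt0 //; apply: ler_sum => k _; exact: bnd.
rewrite sumr_const card_ord -[X in _ * X <= _]mulr_natl le_eqVlt; apply/orP; left.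
by apply/eqP; field.
Qed.

End Urn.

(** * Lower bound on the variance *)

Section VarianceLowerBound.
Variables (R : realFieldType) (n : nat) (S : finType) (p : S -> R).
Hypothesis pP : is_pmf p.
Implicit Types (z : {ffun 'I_n -> S}) (A B : {set 'I_n}) (x a : S).

Local Notation Y := (@nonisolated R n S).

Definition cind x (s : S) : R := (s == x)%:R - p x.

(** The covariance, for a single ball, of the indicators of urns [a] and [x]. *)
Definition cov1 a x : R := p a * ((a == x)%:R - p x).

Lemma cov1C a x : cov1 a x = cov1 x a.
Proof. by rewrite /cov1 eq_sym; case: eqP => [->|] //= _; ring. Qed.

Lemma sum_cind x : \sum_s p s * cind x s = 0.
Proof.
under eq_bigr do rewrite mulrBr.
by rewrite sumrB sum_pmf_eq -mulr_suml pP.2 mul1r subrr.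
Qed.

Lemma sum_ind_cind a x : \sum_s p s * ((s == a)%:R * cind x s) = cov1 a x.
Proof.
rewrite (bigD1 a) //= eqxx mul1r big1 ?addr0 // => s /negbTE ->.
by rewrite mul0r mulr0.
Qed.

Lemma sum_nind_cind a x : \sum_s p s * ((s != a)%:R * cind x s) = - cov1 a x.
Proof.
transitivity (\sum_s p s * cind x s - cov1 a x); last by rewrite sum_cind sub0r.
rewrite -sum_ind_cind -sumrB.
by apply: eq_bigr => s _; case: eqP => _ /=; ring.
Qed.

Lemma sum_cind_cind a x : \sum_s p s * (cind a s * cind x s) = cov1 a x.
Proof.
under eq_bigr do rewrite {1}/cind mulrBl mulrBr [p _ * (p a * _)]mulrCA.
by rewrite sumrB sum_ind_cind -mulr_sumr sum_cind mulr0 subr0.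
Qed.

Definition mono A x z : R := \prod_(i in A) cind x (z i).

Lemma monoE A x z : mono A x z = \prod_i (if i \in A then cind x (z i) else 1).
Proof. by rewrite /mono big_mkcond. Qed.

Lemma Ex_mono A x : A != set0 -> Ex p (mono A x) = 0.
Proof.
move=> /set0Pn[i iA]; under eq_Ex do rewrite monoE.
rewrite (Ex_prod p (fun i s => if i \in A then cind x s else 1)).
by rewrite (bigD1 i) //= iA sum_cind mul0r.
Qed.

(** A ball in exactly one of A and B contributes a centred factor of mean zero, whence
    orthogonality. *)
Lemma Ex_mono2 A B x a :
  Ex p (fun z => mono A x z * mono B a z) =
  if A == B then cov1 x a ^+ #|A| else 0.
Proof.
under eq_Ex do rewrite !monoE -big_split /=.
rewrite (Ex_prod p (fun i s => (if i \in A then cind x s else 1)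
                             * (if i \in B then cind a s else 1))).
have [<-|AB] := eqVneq A B.
  rewrite -prodr_const [in RHS]big_mkcond; apply: eq_bigr => i _ /=.
  case: ifP => _; first exact: sum_cind_cind.
  by under eq_bigr do rewrite !mulr1; exact: pP.2.
have [i iAB] : exists i, (i \in A) != (i \in B).
  apply/existsP; rewrite -[X in is_true X]negbK negb_exists.
  apply: contra AB => /forallP AB; apply/eqP/setP => i; apply/eqP.
  by have := AB i; rewrite negbK.
rewrite (bigD1 i) //=; move: iAB; case: (i \in A); case: (i \in B) => // _.
  by under eq_bigr do rewrite mulr1; rewrite sum_cind mul0r.
by under eq_bigr do rewrite mul1r; rewrite sum_cind mul0r.
Qed.

(** Origin: a product of indicators says that ball i is alone in urn [a]. Testing it against a
    monomial over k balls, the first term collects the k choices of i among them, the second the n -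
    k others. *)
Definition bcoef (k : nat) a : R :=
  k%:R * (1 - p a) ^+ (n - k) - (n - k)%:R * p a * (1 - p a) ^+ (n - k - 1).

(** An isolated ball is alone in exactly one urn [a]; written as a product over balls, this event
    has expectations that factorize. *)
Lemma nonisolated_prodE z :
  Y z = n%:R - \sum_i \sum_a \prod_j
    (if j == i then (z j == a)%:R else (z j != a)%:R).
Proof.
have -> : n%:R = \sum_(i < n) 1 :> R by rewrite sumr_const card_ord.
rewrite /nonisolated -sumrB.
apply: eq_bigr => i _; rewrite (bigD1 (z i)) //= [X in _ - (_ + X)]big1; last first.
  by move=> a; rewrite eq_sym => /negbTE az; rewrite (bigD1 i) //= eqxx az mul0r.
rewrite addr0 (bigD1 i) //= !eqxx mul1r /cnt.
have [/existsP[j /andP[ji zj]]|none] := boolP [exists j, (j != i) && (z j == z i)].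
  rewrite (bigD1 j) //= zj [X in _ - X](bigD1 j) //= (negbTE ji) zj /=.
  by rewrite mul0r subr0.
rewrite big1 => [|j ji]; last first.
  apply/eqP; rewrite eqb0; apply: contra none => zj.
  by apply/existsP; exists j; rewrite ji.
rewrite big1 ?subrr // => j ji; rewrite (negbTE ji).
suff -> : z j != z i by [].
by apply: contra none => zj; apply/existsP; exists j; rewrite ji.
Qed.

Lemma Ex_isolated_mono A x i a :
  Ex p (fun z => \prod_j (if j == i then (z j == a)%:R else (z j != a)%:R)
                 * mono A x z) =
  if i \in A then - ((- cov1 a x) ^+ #|A| * (1 - p a) ^+ (n - #|A|))
  else p a * ((- cov1 a x) ^+ #|A| * (1 - p a) ^+ (n - #|A| - 1)).
Proof.
under eq_Ex do rewrite monoE -big_split /=.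
rewrite (Ex_prod p (fun j s => (if j == i then (s == a)%:R else (s != a)%:R)
   * (if j \in A then cind x s else 1))).
have fac (j : 'I_n) : j != i -> \sum_s p s * ((if j == i then (s == a)%:R
     else (s != a)%:R) * (if j \in A then cind x s else 1)) =
   if j \in A then - cov1 a x else 1 - p a.
  move=> /negbTE ->; case: ifP => _; first exact: sum_nind_cind.
  transitivity (\sum_s p s - \sum_s p s * (s == a)%:R); last first.
    by rewrite sum_pmf_eq pP.2.
  rewrite -sumrB; apply: eq_bigr => s _.
  by case: eqP => _ /=; ring.
rewrite (bigD1 i) //= (eq_bigr _ fac) eqxx.
have cardC : (#|~: A| = n - #|A|)%N by rewrite cardsCs setCK card_ord.
have prodE : \prod_(j in A) (- cov1 a x) * \prod_(j in ~: A) (1 - p a) =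
    \prod_j (if j \in A then - cov1 a x else 1 - p a).
  rewrite [RHS](bigID (mem A)) /=; congr (_ * _).
    by apply: eq_bigr => j ->.
  rewrite (eq_bigl (fun j => j \notin A)) => [|j]; last by rewrite inE.
  by apply: eq_bigr => j /negbTE ->.
case: ifP => iA.
  rewrite sum_ind_cind -[LHS]opprK -mulNr; congr (- _).
  by rewrite -!prodr_const -cardC -prodr_const prodE [in RHS](bigD1 i) //= iA.
under eq_bigr do rewrite mulr1; rewrite sum_pmf_eq; congr (_ * _).
have cardD : (#|(~: A) :\ i| = n - #|A| - 1)%N.
  by rewrite -cardC [in RHS](cardsD1 i) inE iA addnC addnK.
rewrite -cardD -!prodr_const [LHS](bigID (mem A)) /=; congr (_ * _).
  rewrite (eq_bigl (mem A)) => [|j /=]; last first.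
    by case: eqP => [->|]//=; rewrite iA.
  by apply: eq_bigr => j /= ->.
rewrite (eq_bigl (mem ((~: A) :\ i))) => [|j /=]; last by rewrite !inE.
by apply: eq_bigr => j /=; rewrite !inE => /andP[_ /negbTE ->].
Qed.

Lemma Ex_nonisolated_mono A x : A != set0 ->
  Ex p (fun z => Y z * mono A x z) = \sum_a (- cov1 a x) ^+ #|A| * bcoef #|A| a.
Proof.
move=> A0.
rewrite (eq_Ex _ (G := fun z => n%:R * mono A x z - \sum_i \sum_a
  (\prod_j (if j == i then (z j == a)%:R else (z j != a)%:R) * mono A x z))); last first.
  move=> z; rewrite nonisolated_prodE mulrBl mulr_suml; congr (_ - _).
  by apply: eq_bigr => i _; rewrite mulr_suml.
rewrite ExB ExZ Ex_mono // mulr0 sub0r Ex_sum.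
under eq_bigr do rewrite Ex_sum.
rewrite exchange_big -sumrN; apply: eq_bigr => a _ /=.
under eq_bigr do rewrite Ex_isolated_mono.
rewrite (bigID (mem A)) /=.
rewrite (eq_bigr (fun=> - ((- cov1 a x) ^+ #|A| * (1 - p a) ^+ (n - #|A|)))); last first.
  by move=> i ->.
rewrite [X in - (_ + X)](eq_bigr (fun=> p a *
  ((- cov1 a x) ^+ #|A| * (1 - p a) ^+ (n - #|A| - 1)))); last first.
  by move=> i /negbTE ->.
rewrite !sumr_const.
have -> : #|(fun i : 'I_n => i \notin A)| = (n - #|A|)%N.
  have := cardC (mem A); rewrite card_ord => /(congr1 (subn^~ #|A|)).
  by rewrite /= addKn => <-; apply: eq_card => i.
rewrite -[X in - (X + _)]mulr_natl -[X in - (_ + X)]mulr_natl /bcoef.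
by rewrite -[#|mem A|]/#|A|; ring.
Qed.

(* The component of Y on the kernels depending on the balls in A, in the
   Hoeffding decomposition. *)
Definition proj A z : R :=
  \sum_x (-1) ^+ #|A| * bcoef #|A| x * mono A x z.

Definition proj_norm2 (k : nat) : R :=
  \sum_x \sum_a bcoef k x * bcoef k a * cov1 x a ^+ k.

Lemma Ex_proj A : A != set0 -> Ex p (proj A) = 0.
Proof.
move=> A0; rewrite /proj Ex_sum big1 // => x _.
by rewrite ExZ Ex_mono // mulr0.
Qed.

Lemma Ex_nonisolated_proj A : A != set0 ->
  Ex p (fun z => Y z * proj A z) = proj_norm2 #|A|.
Proof.
move=> A0; under eq_Ex do rewrite /proj mulr_sumr.
rewrite Ex_sum; apply: eq_bigr => x _.
under eq_Ex do rewrite mulrCA.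
rewrite ExZ Ex_nonisolated_mono // mulr_sumr; apply: eq_bigr => a _.
rewrite -[- cov1 a x]mulN1r exprMn (cov1C a x).
have : (-1) ^+ #|A| * (-1) ^+ #|A| = 1 :> R by rewrite -exprMn mulrNN mulr1 expr1n.
set e := (-1) ^+ _ => ee.
rewrite -[RHS]mul1r -ee; ring.
Qed.

Lemma Ex_proj2 A B : Ex p (fun z => proj A z * proj B z) =
  if A == B then proj_norm2 #|A| else 0.
Proof.
under eq_Ex do rewrite /proj mulr_suml.
rewrite Ex_sum; under eq_bigr => x _.
  under eq_Ex => z do rewrite mulr_sumr.
  rewrite Ex_sum; under eq_bigr => a _.
    under eq_Ex => z do rewrite mulrACA.
    rewrite ExZ Ex_mono2.
  over.
over.
case: eqP => [<-|_]; last first.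
  by apply: big1 => x _; apply: big1 => a _; rewrite mulr0.
apply: eq_bigr => x _; apply: eq_bigr => a _.
have : (-1) ^+ #|A| * (-1) ^+ #|A| = 1 :> R by rewrite -exprMn mulrNN mulr1 expr1n.
set e := (-1) ^+ _ => ee.
rewrite -[RHS]mul1r -ee; ring.
Qed.

(** The components are orthogonal and each has the same inner product with Y as with itself, so the
    claim is E (Y - E Y - L)^2 >= 0 for their sum L. *)
Lemma Bessel_nonisolated (P : pred {set 'I_n}) : ~~ P set0 ->
  \sum_(A | P A) proj_norm2 #|A| <= Ex p (fun z => Y z ^+ 2) - Ex p Y ^+ 2.
Proof.
move=> P0; have An0 A : P A -> A != set0.
  by apply: contraTneq => ->.
have [m Em] : exists m, m = Ex p Y by exists (Ex p Y).
rewrite -Em; set V := \sum_(A | _) _.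
pose L z := \sum_(A | P A) proj A z.
have EL : Ex p L = 0.
  by rewrite /L Ex_sum big1 // => A /An0; exact: Ex_proj.
have EYL : Ex p (fun z => Y z * L z) = V.
  under eq_Ex do rewrite /L mulr_sumr.
  by rewrite Ex_sum; apply: eq_bigr => A /An0; exact: Ex_nonisolated_proj.
have ELL : Ex p (fun z => L z * L z) = V.
  under eq_Ex do rewrite /L mulr_suml.
  rewrite Ex_sum; apply: eq_bigr => A PA.
  under eq_Ex do rewrite mulr_sumr.
  rewrite Ex_sum (bigD1 A) //= Ex_proj2 eqxx big1 ?addr0 // => B /andP[_].
  by rewrite Ex_proj2 eq_sym => /negbTE ->.
have : 0 <= Ex p (fun z => (Y z - m - L z) ^+ 2).
  by apply: (Ex_ge0 pP) => z; exact: sqr_ge0.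
have -> : Ex p (fun z => (Y z - m - L z) ^+ 2) =
   Ex p (fun z => Y z ^+ 2) - 2 * m * Ex p Y + m ^+ 2
   - 2 * Ex p (fun z => Y z * L z) + 2 * m * Ex p L + Ex p (fun z => L z * L z).
  rewrite -!ExZ -[m ^+ 2](Ex_cst n pP) -ExB -ExD -ExB -!ExD.
  by apply: eq_Ex => z; ring.
rewrite EYL EL ELL -Em; lra.
Qed.

Hypothesis p_le : forall x, p x <= 1 / 11.

(** Off the diagonal the covariance is - p_x p_a; its square completes the double sum to a perfect
    square, which is dropped. The diagonal keeps 1 - 2 p_x >= 9/11. *)
Lemma proj_norm2_2_ge :
  9 / 11 * \sum_x bcoef 2 x ^+ 2 * p x ^+ 2 <= proj_norm2 2.
Proof.
have -> : proj_norm2 2 = \sum_x bcoef 2 x ^+ 2 * p x ^+ 2 * (1 - 2 * p x)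
   + (\sum_x bcoef 2 x * p x ^+ 2) ^+ 2.
  rewrite expr2 mulr_suml -big_split; apply: eq_bigr => x _ /=.
  rewrite mulr_sumr (bigD1 x) //= [in RHS](bigD1 x) //= /cov1 eqxx /=.
  rewrite addrA; congr (_ + _); first by ring.
  by apply: eq_bigr => a ax; rewrite eq_sym (negbTE ax) /=; ring.
rewrite mulr_sumr -[leLHS]addr0; apply: lerD; last exact: sqr_ge0.
apply: ler_sum => x _; rewrite mulrC; apply: ler_wpM2l; first by apply: mulr_ge0; exact: sqr_ge0.
have := p_le x; lra.
Qed.

(** In odd order the perfect square is subtracted. Cauchy-Schwarz with weights p bounds it by 1/11
    of the main sum, and 1 - 3p + 3p^2 >= 33/50 + 1/11 for p <= 1/11. *)
Lemma proj_norm2_3_ge :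
  33 / 50 * \sum_x bcoef 3 x ^+ 2 * p x ^+ 3 <= proj_norm2 3.
Proof.
have p_ge0 := pP.1.
set b := bcoef 3.
have -> : proj_norm2 3 = \sum_x b x ^+ 2 * p x ^+ 3 * (1 - 3 * p x + 3 * p x ^+ 2)
   - (\sum_x b x * p x ^+ 3) ^+ 2.
  rewrite expr2 mulr_suml -sumrB; apply: eq_bigr => x _ /=.
  rewrite mulr_sumr (bigD1 x) //= [in RHS](bigD1 x) //= /cov1 eqxx -/b /=.
  rewrite opprD addrA -sumrN; congr (_ + _); first by ring.
  by apply: eq_bigr => a ax; rewrite eq_sym (negbTE ax) /=; ring.
have : (\sum_x b x * p x ^+ 3) ^+ 2 <= 1 / 11 * \sum_x b x ^+ 2 * p x ^+ 3.
  set m := \sum_x _.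
  have : 0 <= \sum_x p x * (b x * p x ^+ 2 - m) ^+ 2.
    by apply: sumr_ge0 => x _; rewrite mulr_ge0 ?sqr_ge0.
  have -> : \sum_x p x * (b x * p x ^+ 2 - m) ^+ 2 =
      \sum_x p x * (b x * p x ^+ 2) ^+ 2 - m ^+ 2.
    transitivity (\sum_x (p x * (b x * p x ^+ 2) ^+ 2
        - 2 * m * (b x * p x ^+ 3) + m ^+ 2 * p x)).
      by apply: eq_bigr => x _; ring.
    rewrite big_split sumrB /= -!mulr_sumr pP.2 -/m; ring.
  rewrite subr_ge0 => /le_trans; apply; rewrite mulr_sumr; apply: ler_sum => x _.
  have -> : p x * (b x * p x ^+ 2) ^+ 2 = p x ^+ 2 * (b x ^+ 2 * p x ^+ 3) by ring.
  apply: ler_wpM2r; first by apply: mulr_ge0; [exact: sqr_ge0|exact: exprn_ge0].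
  have := p_le x; have := p_ge0 x; nra.
have : (33 / 50 + 1 / 11) * \sum_x b x ^+ 2 * p x ^+ 3 <=
    \sum_x b x ^+ 2 * p x ^+ 3 * (1 - 3 * p x + 3 * p x ^+ 2).
  rewrite mulr_sumr; apply: ler_sum => x _.
  rewrite mulrC; apply: ler_wpM2l.
    by apply: mulr_ge0; [exact: sqr_ge0|exact: exprn_ge0].
  have := p_le x; have := p_ge0 x; nra.
lra.
Qed.

(* The second- and third-order coefficients vanish near n p = 2 and n p = 3
   respectively, never both. *)
Lemma bcoef_ge x : (4 <= n)%N ->
  1 / 14 * (1 - p x) ^+ (2 * n) <= 9 / 11 * bcoef 2 x ^+ 2
    + (n - 2)%:R / 3 * p x * (33 / 50) * bcoef 3 x ^+ 2.
Proof.
move=> n4; rewrite /bcoef.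
have -> : (2 * n = (n - 4) * 2 + 8)%N by lia.
have -> : (n - 3 - 1 = n - 4)%N by lia.
have -> : (n - 2 - 1 = (n - 4) + 1)%N by lia.
have -> : (n - 2)%N = ((n - 4) + 2)%N by lia.
have -> : (n - 3)%N = ((n - 4) + 1)%N by lia.
set k := (n - 4)%N; rewrite !exprD exprM.
set Q := (1 - p x) ^+ k.
set u : R := (k + 2)%:R * p x.
have u0 : 0 <= u by rewrite mulr_ge0 ?pP.1.
have -> : (k + 1)%:R = (k + 2)%:R - 1 :> R by rewrite !natrD; ring.
have -> : 9 / 11 * (2 * (Q * (1 - p x) ^+ 2) - (k + 2)%:R * p x * (Q * (1 - p x) ^+ 1)) ^+ 2 =
   Q ^+ 2 * (9 / 11 * (1 - p x) ^+ 2 * (2 * (1 - p x) - u) ^+ 2) by rewrite /u; field.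
have -> : (k + 2)%:R / 3 * p x * (33 / 50) *
    (3 * (Q * (1 - p x) ^+ 1) - ((k + 2)%:R - 1) * p x * Q) ^+ 2 =
   Q ^+ 2 * (11 / 50 * u * (3 - 2 * p x - u) ^+ 2) by rewrite /u; field.
rewrite -mulrDr mulrCA ler_wpM2l ?sqr_ge0 //.
have q8 : (1 - p x) ^+ 8 <= (1 - p x) ^+ 2.
  by rewrite ler_wiXn2l //; have := p_le x; have := pP.1 x; lra.
have q2 : (1 - p x) ^+ 2 <= 1.
  by rewrite exprn_ile1 //; have := p_le x; have := pP.1 x; lra.
have q2' := sqr_ge0 (1 - p x).
have := p_le x; have := pP.1 x; move: (p x) q8 q2 q2' => t q8 q2 q2' t0 t1.
(* If the second-order factor is at least 1/2 in absolute value, it suffices alone. Otherwise the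
   third-order factor, larger by exactly 1, exceeds 1/2 and u >= 29/22, which gives 11/50 * 29/22 *
   1/4 = 29/400 >= 1/14. *)
have [far|near] := lerP (1 / 4) ((2 * (1 - t) - u) ^+ 2).
  have : 0 <= 11 / 50 * u * (3 - 2 * t - u) ^+ 2.
    by apply: mulr_ge0; [lra|exact: sqr_ge0].
  nra.
have u1 : 2 * (1 - t) - u < 1 / 2 by nra.
have u2 : 2 * (1 - t) - u > - (1 / 2) by nra.
have h1 : 1 / 4 <= (3 - 2 * t - u) ^+ 2 by nra.
have h2 : 29 / 22 <= u by lra.
have : 0 <= 9 / 11 * (1 - t) ^+ 2 * (2 * (1 - t) - u) ^+ 2.
  by apply: mulr_ge0; [lra|exact: sqr_ge0].
nra.
Qed.

Lemma variance_ge : (4 <= n)%N ->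
  'C(n, 2)%:R / 14 * \sum_x p x ^+ 2 * (1 - p x) ^+ (2 * n)
    <= Ex p (fun z => Y z ^+ 2) - Ex p Y ^+ 2.
Proof.
move=> n4.
apply: le_trans (@Bessel_nonisolated (fun A => (#|A| == 2) || (#|A| == 3)) _); last first.
  by rewrite cards0.
rewrite (bigID (fun A => #|A| == 2)) /=.
have -> : \sum_(A : {set 'I_n} | ((#|A| == 2) || (#|A| == 3)) && (#|A| == 2))
    proj_norm2 #|A| = 'C(n, 2)%:R * proj_norm2 2.
  rewrite -[in RHS](card_ord n) -card_draws mulr_natl -sumr_const.
  apply: eq_big => [A|A /andP[_ /eqP ->//]]; rewrite inE.
  by case: eqP => // _; rewrite andbF.
have -> : \sum_(A : {set 'I_n} | ((#|A| == 2) || (#|A| == 3)) && (#|A| != 2))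
    proj_norm2 #|A| = 'C(n, 3)%:R * proj_norm2 3.
  rewrite -[in RHS](card_ord n) -card_draws mulr_natl -sumr_const.
  apply: eq_big => [A|A /andP[]]; last by case: eqP => //= _ /eqP ->.
  by rewrite inE; case: eqP => [->|] //=; rewrite andbT.
(* Both orders then share the factor C(n, 2), and the urn-by-urn bound [bcoef_ge] applies. *)
have -> : 'C(n, 3)%:R = 'C(n, 2)%:R * ((n - 2)%:R / 3) :> R.
  have : (3 * 'C(n, 3) = (n - 2) * 'C(n, 2))%N by exact: mul_bin_left.
  move=> /(congr1 (fun k => k%:R : R)); rewrite !natrM => E.
  by rewrite mulrA [_ * (n - 2)%:R]mulrC -E; field.
apply: (@le_trans _ _ ('C(n, 2)%:R * (9 / 11 * \sum_x bcoef 2 x ^+ 2 * p x ^+ 2)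
   + 'C(n, 2)%:R * ((n - 2)%:R / 3) * (33 / 50 * \sum_x bcoef 3 x ^+ 2 * p x ^+ 3)));
  last first.
  apply: lerD; first by rewrite ler_wpM2l // proj_norm2_2_ge.
  by rewrite ler_wpM2l ?proj_norm2_3_ge // mulr_ge0 // divr_ge0.
rewrite -!mulrA -mulrDr ler_wpM2l // !mulr_sumr -big_split /=.
apply: ler_sum => x _; have := bcoef_ge x n4.
move=> /(ler_wpM2l (sqr_ge0 (p x))) /= h.
apply: le_trans (le_trans h _).
  by rewrite mulrCA div1r.
by rewrite le_eqVlt; apply/orP; left; apply/eqP; field.
Qed.

End VarianceLowerBound.

(** * Stein's method *)

(** Cauchy-Schwarz for the centred Q: a factor with second moment at most 1 may be decoupled from Q
    at the price v. *)
Lemma Ex_le_mean_dev (R : realFieldType) (n : nat) (S : finType) (p : S -> R)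
    (Q G : {ffun 'I_n -> S} -> R) (v : R) :
  is_pmf p -> 0 <= v -> Ex p (fun z => Q z ^+ 2) - Ex p Q ^+ 2 <= v ^+ 2 ->
  Ex p (fun z => G z ^+ 2) <= 1 ->
  Ex p (fun z => Q z * G z) <= Ex p Q * Ex p G + v.
Proof.
move=> pP v0 Qv G1; have [m Em] : exists m, m = Ex p Q by exists (Ex p Q).
rewrite -Em in Qv *.
have -> : Ex p (fun z => Q z * G z) =
    m * Ex p G + Ex p (fun z => (Q z - m) * G z).
  by rewrite -ExZ -ExD; apply: eq_Ex => z; ring.
rewrite lerD2l.
have var : Ex p (fun z => (Q z - m) ^+ 2) <= v ^+ 2.
  by apply: le_trans Qv; rewrite Em Ex_sqr_dev.
have cs := Ex_CauchySchwarz pP (fun z => Q z - m) G.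
rewrite leNgt; apply/negP => lt.
have : v ^+ 2 < Ex p (fun z => (Q z - m) * G z) ^+ 2 by rewrite ltrXn2r ?nnegrE.
apply/negP; rewrite -leNgt; apply: (le_trans cs).
apply: (@le_trans _ _ (v ^+ 2 * 1)); last by rewrite mulr1.
by apply: ler_pM => //; apply: (Ex_ge0 pP) => z; exact: sqr_ge0.
Qed.

Section SteinBound.
Variables (R : realFieldType) (n : nat) (S : finType) (p : S -> R).
Hypothesis pP : is_pmf p.
Local Notation Y := (@nonisolated R n S).
Local Notation Ex2 := (Ex (pmf_pair p)).
Variable sigma : R.
Hypothesis sigma_ge2 : 2 <= sigma.
Hypothesis sigma2 : sigma ^+ 2 = Ex p (fun x => Y x ^+ 2) - Ex p Y ^+ 2.

Let sigma_gt0 : 0 < sigma. Proof. by apply: lt_le_trans sigma_ge2. Qed.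
Let sigma_neq0 : sigma != 0. Proof. by rewrite gt_eqF. Qed.

Definition standardized (x : {ffun 'I_n -> S}) : R := (Y x - Ex p Y) / sigma.
Local Notation W := standardized.

Definition std_cdf (t : R) : R := Ex p (fun x => (W x <= t)%R%:R).

Variables (Phi : R -> R) (f : R -> R -> R).
Definition stein_deriv (s w : R) : R := w * f s w + (w <= s)%R%:R - Phi s.
Hypothesis Phi_lip : forall s t, s <= t -> 0 <= Phi t - Phi s <= (t - s) / 2.
Hypothesis deriv_le : forall s w, `|stein_deriv s w| <= 2.
Hypothesis taylor : forall s w w', `|w' - w| <= 1 ->
  `|f s w' - f s w - (w' - w) * stein_deriv s w| <=
  (w' - w) ^+ 2 * (8 + 2 * `|w|) + 4 * `|w' - w| * ((w <= s) != (w' <= s))%R%:R.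

Variables (a v kappa : R).
Hypotheses (a_ge0 : 0 <= a) (v_ge0 : 0 <= v).
Local Notation T0 := (@qsum R n S id).
Local Notation Q := (@qsum R n S (fun t => `|t|)).
Hypothesis Q_mean : Ex2 Q <= 16 * a.
Hypothesis Q_var : Ex2 (fun z => Q z ^+ 2) - Ex2 Q ^+ 2 <= v ^+ 2.
Hypothesis T_var : Ex2 (fun z => T0 z ^+ 2) - Ex2 T0 ^+ 2 <= v ^+ 2.
Hypothesis kappaP : forall t, `|std_cdf t - Phi t| <= kappa.

Let pP2 : is_pmf (pmf_pair p). Proof. exact: pmf_pairP. Qed.

Lemma Q_ge0 z : 0 <= Q z. Proof. exact: sumr_ge0. Qed.

Lemma Ex_standardized : Ex p W = 0.
Proof.
rewrite /standardized; under eq_Ex do rewrite mulrC.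
by rewrite ExZ ExB Ex_cst // subrr mulr0.
Qed.

Lemma Ex_standardized2 : Ex p (fun x => W x ^+ 2) = 1.
Proof.
have [m Em] : exists m, m = Ex p Y by exists (Ex p Y).
rewrite /standardized -Em.
transitivity (sigma ^-2 * (Ex p (fun x => Y x ^+ 2) - 2 * m * Ex p Y + m ^+ 2)).
  rewrite -!ExZ -[m ^+ 2](Ex_cst n pP) -ExB -ExD -ExZ; apply: eq_Ex => x.
  by field.
have -> : Ex p (fun x => Y x ^+ 2) = sigma ^+ 2 + m ^+ 2 by rewrite sigma2 -Em subrK.
by rewrite -Em; field.
Qed.

Definition quad_var z : R := T0 z / (2 * sigma ^+ 2).

Lemma standardized_hyb (i : 'I_n) z : W (hyb i z) - W (hyb i.+1 z) = incr1 R i z / sigma.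
Proof. by rewrite /standardized /incr1; field. Qed.

Lemma standardized_one (i : 'I_n) z : W (hyb 0 z) - W (one i z) = incr2 R i z / sigma.
Proof. by rewrite /standardized /incr2; field. Qed.

Lemma Ex_quad_var : Ex2 quad_var = 1.
Proof.
rewrite -[RHS]Ex_standardized2 -[RHS]subr0 -(mulr0 (Ex p W)) -[in RHS]Ex_standardized.
under [in RHS]eq_Ex do rewrite expr2.
rewrite (covariance_identity pP) -Ex_sum -ExZ; apply: eq_Ex => z.
rewrite /quad_var /qsum mulr_suml mulr_sumr; apply: eq_bigr => i _.
by rewrite standardized_hyb standardized_one; field.
Qed.

Lemma quad_var_dev : Ex2 (fun z => `|1 - quad_var z|) <= v / (2 * sigma ^+ 2).
Proof.
have s2 : 0 < 2 * sigma ^+ 2 by rewrite mulr_gt0 ?exprn_gt0.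
have ET : Ex2 T0 = 2 * sigma ^+ 2.
  have <- : Ex2 (fun z => (2 * sigma ^+ 2) * quad_var z) = Ex2 T0.
    by apply: eq_Ex => z; rewrite /quad_var mulrC divfK // gt_eqF.
  by rewrite ExZ Ex_quad_var mulr1.
(* Pairing the deviation with its own sign turns the first absolute moment into a product that can
   be decoupled. *)
pose G (z : {ffun 'I_n -> S * S}) : R := Num.sg (T0 z - Ex2 T0).
have G1 : Ex2 (fun z => G z ^+ 2) <= 1.
  rewrite -(Ex_cst n pP2 1); apply: (Ex_le pP2) => z.
  by rewrite /G sqr_sg; case: eqP.
have := Ex_le_mean_dev pP2 v_ge0 T_var G1.
rewrite -lerBlDl -ExZ -ExB => h.
rewrite ler_pdivlMr // mulrC -ExZ; apply: le_trans h.
apply: (Ex_le pP2) => z; rewrite -mulrBl /G [leRHS]mulrC -normrEsg distrC.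
rewrite -[X in X * _ <= _](ger0_norm (ltW s2)) -normrM mulrBr mulr1 -ET.
by rewrite /quad_var -ET [_ * (_ / _)]mulrC divfK // ET gt_eqF.
Qed.

Definition remainder s (i : 'I_n) z : R :=
  f s (W (one i z)) - f s (W (hyb 0 z))
  - (W (one i z) - W (hyb 0 z)) * stein_deriv s (W (hyb 0 z)).

Lemma stein_identity s : std_cdf s - Phi s =
  Ex2 (fun z => stein_deriv s (W (hyb 0 z)) * (1 - quad_var z)) +
  Ex2 (fun z => (2 * sigma)^-1 * \sum_i incr1 R i z * remainder s i z).
Proof.
have -> : std_cdf s - Phi s =
    Ex p (fun x => stein_deriv s (W x)) - Ex p (fun x => W x * f s (W x)).
  rewrite /std_cdf -[Phi s](Ex_cst n pP) -!ExB; apply: eq_Ex => x.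
  by rewrite /stein_deriv; ring.
have -> : Ex p (fun x => W x * f s (W x)) =
    Ex p (fun x => W x * f s (W x)) - Ex p W * Ex p (fun x => f s (W x)).
  by rewrite Ex_standardized mul0r subr0.
rewrite (covariance_identity pP) -Ex_sum -ExZ -(Ex2_fst pP) -ExB -ExD.
apply: eq_Ex => z /=.
rewrite /quad_var /qsum mulrBr mulr1 -[RHS]addrA; congr (_ + _).
rewrite mulr_suml !mulr_sumr -sumrN -sumrN -big_split /=.
apply: eq_bigr => i _; rewrite /remainder standardized_hyb.
rewrite -[W (one i z) - _]opprB standardized_one; field.
exact: sigma_neq0.
Qed.

(** The indicator of w - 2/sigma <= s < w + 2/sigma, where 2/sigma bounds the effect of one move.
    Written as a difference, it telescopes along the lattice. *)
Definition near s w : R := (w - 2 / sigma <= s)%R%:R - (w + 2 / sigma <= s)%R%:R.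

Lemma cross_le_near s w w' : `|w' - w| <= 2 / sigma ->
  ((w <= s) != (w' <= s))%R%:R <= near s w.
Proof.
rewrite /near ler_norml => /andP[h1 h2].
by case: (lerP w s) => h3; case: (lerP w' s) => h4;
  case: (lerP (w - _)) => h5; case: (lerP (w + _)) => h6 //=; lra.
Qed.

(** In the quadratic Taylor term one factor [incr2] is bounded by 2, so that both error terms keep
    the product [incr1] times [incr2] and sum to [Q]. *)
Lemma remainder_le s z :
  `|(2 * sigma)^-1 * \sum_i incr1 R i z * remainder s i z| <=
  sigma ^-3 * (Q z * (8 + 2 * `|W (hyb 0 z)|))
  + 2 * sigma ^-2 * (Q z * near s (W (hyb 0 z))).
Proof.
rewrite normrM ger0_norm; last by rewrite invr_ge0 mulr_ge0 // ltW.
apply: (@le_trans _ _ ((2 * sigma)^-1 * \sum_i `|incr1 R i z * incr2 R i z| *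
  (2 * sigma ^-2 * (8 + 2 * `|W (hyb 0 z)|) + 4 * sigma^-1 * near s (W (hyb 0 z))))).
  rewrite ler_pM2l; last by rewrite invr_gt0 mulr_gt0.
  apply: (le_trans (ler_norm_sum _ _ _)); apply: ler_sum => i _.
  rewrite normrM [`|_ * incr2 _ _ _|]normrM -[leRHS]mulrA; apply: ler_wpM2l => //.
  have dE : W (one i z) - W (hyb 0 z) = - (incr2 R i z / sigma).
    by rewrite -standardized_one opprB.
  have dN : `|W (one i z) - W (hyb 0 z)| = `|incr2 R i z| / sigma.
    by rewrite dE normrN normrM normfV (ger0_norm (ltW sigma_gt0)).
  have d2 : `|W (one i z) - W (hyb 0 z)| <= 2 / sigma.
    by rewrite dN ler_pM2r ?invr_gt0 // incr2_le.
  have d1 : `|W (one i z) - W (hyb 0 z)| <= 1.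
    by apply: (le_trans d2); rewrite ler_pdivrMr // mul1r.
  apply: (le_trans (taylor s d1)).
  rewrite dN dE sqrrN [leRHS]mulrDr; apply: lerD.
    rewrite [leRHS]mulrA; apply: ler_wpM2r; first by rewrite addr_ge0 ?mulr_ge0.
    rewrite expr_div_n -[X in X / _ <= _]real_normK ?num_real // expr2 -mulrA.
    by apply: ler_wpM2l => //; rewrite ler_wpM2r ?incr2_le // invr_ge0 exprn_ge0 // ltW.
  have -> : 4 * (`|incr2 R i z| / sigma) * ((W (hyb 0 z) <= s) != (W (one i z) <= s))%R%:R
    = `|incr2 R i z| * (4 / sigma * ((W (hyb 0 z) <= s) != (W (one i z) <= s))%R%:R).
    by ring.
  rewrite ler_wpM2l // ler_wpM2l ?cross_le_near // divr_ge0 // ltW //.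
rewrite -mulr_suml le_eqVlt; apply/orP; left; apply/eqP.
rewrite /qsum; set q := \sum_i _; field.
exact: sigma_neq0.
Qed.

Section Average.
Variables (s : R) (M : nat).

Let u (j : nat) : R := s + j%:R / sigma.

(** The half-width 2/sigma is two lattice steps, so the j-th term is h(j + 4) - h(j) and four terms
    survive at each end. The offset 2 makes the window start at [u 0]. *)
Lemma sum_near w :
  \sum_(j < M) near (u (j + 2)) w <= 4 * ((u 0 < w) && (w <= u (M + 4)))%R%:R.
Proof.
pose h (j : nat) : R := (w <= u j)%R%:R.
have nearE j : near (u (j + 2)) w = h (j + 4)%N - h j.
  rewrite /near /h /u !natrD; congr (_%:R - _%:R); congr nat_of_bool.
    by rewrite lerBlDr -addrA -mulrDl; congr (_ <= _ + _ * _); ring.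
  by rewrite -lerBrDr; congr (_ <= _); field; exact: sigma_neq0.
under eq_bigr do rewrite nearE.
have u_mono i j : (i <= j)%N -> u i <= u j.
  by move=> ij; rewrite /u lerD2l ler_pM2r ?invr_gt0 // ler_nat.
have h_mono i j : (i <= j)%N -> h i <= h j.
  move=> ij; rewrite /h; case: (lerP w (u i)) => // wi.
  by rewrite (le_trans wi (u_mono _ _ ij)).
have -> : \sum_(j < M) (h (j + 4)%N - h j) =
  h M + h M.+1 + h M.+2 + h M.+3 - (h 0%N + h 1%N + h 2%N + h 3%N).
  elim: (M) => [|k IH]; first by rewrite big_ord0 subrr.
  by rewrite big_ord_recr /= IH addn4; ring.
have -> : ((u 0 < w) && (w <= u (M + 4)))%R%:R = h (M + 4)%N - h 0%N.
  rewrite /h ltNge; case: (lerP w (u 0)) => //= w0; last by rewrite subr0.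
  by rewrite (le_trans w0 (u_mono _ _ _)) // subrr.
have := (h_mono 0%N 1%N isT, h_mono 0%N 2%N isT, h_mono 0%N 3%N isT).
have : [/\ h M <= h (M + 4)%N, h M.+1 <= h (M + 4)%N, h M.+2 <= h (M + 4)%N
  & h M.+3 <= h (M + 4)%N] by split; apply: h_mono; rewrite addn4; do 5?[exact: leqnn | apply: leqW].
by move=> [? ? ? ?] [[? ?] ?]; lra.
Qed.

Lemma Ex_window :
  Ex p (fun x => ((u 0 < W x) && (W x <= u (M + 4)))%R%:R)
  <= 2 * kappa + (M + 4)%:R / (2 * sigma).
Proof.
have u_mono : u 0 <= u (M + 4).
  by rewrite /u lerD2l ler_pM2r ?invr_gt0 // ler_nat.
have -> : Ex p (fun x => ((u 0 < W x) && (W x <= u (M + 4)))%R%:R) =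
    std_cdf (u (M + 4)) - std_cdf (u 0).
  rewrite /std_cdf -ExB; apply: eq_Ex => x.
  rewrite ltNge; case: (lerP (W x) (u 0)) => //= w0; last by rewrite subr0.
  by rewrite (le_trans w0 u_mono) subrr.
have := kappaP (u (M + 4)); have := kappaP (u 0); have := Phi_lip u_mono.
have -> : u (M + 4) - u 0 = (M + 4)%:R / sigma by rewrite /u; field; exact: sigma_neq0.
have -> : (M + 4)%:R / sigma / 2 = (M + 4)%:R / (2 * sigma) by field; exact: sigma_neq0.
rewrite !ler_norml; lra.
Qed.

(** The three terms come from the deviation of T from 1, the smooth Taylor error and the jumps. Here
    160 = 8 * 16 + 2 * 16, by E |W| <= 1. *)
Lemma average_le :
  `|\sum_(j < M) (std_cdf (u (j + 2)) - Phi (u (j + 2)))| <=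
  M%:R * (v / sigma ^+ 2) + M%:R * ((160 * a + 2 * v) / sigma ^+ 3)
  + 8 / sigma ^+ 2 * (16 * a * (2 * kappa + (M + 4)%:R / (2 * sigma)) + v).
Proof.
under eq_bigr do rewrite stein_identity.
rewrite big_split /=; apply: (le_trans (ler_normD _ _)).
rewrite -addrA; apply: lerD.
  apply: (le_trans (ler_norm_sum _ _ _)).
  apply: (@le_trans _ _ (\sum_(j < M) v / sigma ^+ 2)); last first.
    by rewrite sumr_const card_ord -[leLHS]mulr_natl.
  apply: ler_sum => j _; apply: (le_trans (Ex_norm pP2 _)).
  apply: (@le_trans _ _ (Ex2 (fun z => 2 * `|1 - quad_var z|))).
    by apply: (Ex_le pP2) => z; rewrite normrM ler_wpM2r.
  rewrite ExZ (_ : v / sigma ^+ 2 = 2 * (v / (2 * sigma ^+ 2))).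
    by rewrite ler_pM2l // quad_var_dev.
  by field; exact: sigma_neq0.
pose win (z : {ffun 'I_n -> S * S}) : R :=
  ((u 0 < W (hyb 0 z)) && (W (hyb 0 z) <= u (M + 4)))%R%:R.
apply: (@le_trans _ _ (Ex2 (fun z => M%:R * sigma ^-3 * (Q z * (8 + 2 * `|W (hyb 0 z)|))
   + 8 * sigma ^-2 * (Q z * win z)))).
  rewrite -Ex_sum; apply: (le_trans (Ex_norm pP2 _)); apply: (Ex_le pP2) => z.
  apply: (le_trans (ler_norm_sum _ _ _)).
  apply: (@le_trans _ _ (\sum_(j < M) (sigma ^-3 * (Q z * (8 + 2 * `|W (hyb 0 z)|))
  + 2 * sigma ^-2 * (Q z * near (u (j + 2)) (W (hyb 0 z)))))).
    by apply: ler_sum => j _; exact: remainder_le.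
  rewrite big_split /= sumr_const card_ord -[X in X + _ <= _]mulr_natl mulrA lerD2l.
  rewrite -!mulr_sumr.
  have := sum_near (W (hyb 0 z)); rewrite -/(win z).
  move=> /(ler_wpM2l (Q_ge0 z)) h.
  have -> : 8 * sigma ^-2 * (Q z * win z) = 2 * sigma ^-2 * (Q z * (4 * win z)).
    by ring.
  rewrite ler_wpM2l // mulr_ge0 // invr_ge0 exprn_ge0 // ltW //.
rewrite ExD !ExZ; apply: lerD.
  rewrite -mulrA ler_wpM2l // mulrC ler_pM2r ?invr_gt0 ?exprn_gt0 //.
  have W2 : Ex2 (fun z => `|W (hyb 0 z)| ^+ 2) <= 1.
    rewrite (Ex2_fst pP (fun x => `|W x| ^+ 2)) -Ex_standardized2.
    by apply: (Ex_le pP) => x; rewrite real_normK ?num_real.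
  have W1 : Ex2 (fun z => `|W (hyb 0 z)|) <= 1.
    have := Ex_CauchySchwarz pP2 (fun _ => 1) (fun z => `|W (hyb 0 z)|).
    set e := Ex2 (fun z => 1 * _).
    have eE : e = Ex2 (fun z => `|W (hyb 0 z)|) by apply: eq_Ex => z; rewrite mul1r.
    rewrite /= (Ex_cst n pP2) expr1n mul1r => /le_trans /(_ W2); rewrite eE.
    have : 0 <= Ex2 (fun z => `|W (hyb 0 z)|) by apply: (Ex_ge0 pP2).
    nra.
  have := Ex_le_mean_dev pP2 v_ge0 Q_var W2.
  have -> : Ex2 (fun z => Q z * (8 + 2 * `|W (hyb 0 z)|)) =
     8 * Ex2 Q + 2 * Ex2 (fun z => Q z * `|W (hyb 0 z)|).
    by rewrite -!ExZ -ExD; apply: eq_Ex => z; ring.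
  have Q0 : 0 <= Ex2 Q by apply: (Ex_ge0 pP2); exact: Q_ge0.
  have : Ex2 Q * Ex2 (fun z => `|W (hyb 0 z)|) <= Ex2 Q by rewrite ler_piMr.
  move: Q_mean; lra.
rewrite ler_pM2l; last by rewrite mulr_gt0 // invr_gt0 exprn_gt0.
have win2 : Ex2 (fun z => win z ^+ 2) <= 1.
  rewrite -[leRHS](Ex_cst n pP2); apply: (Ex_le pP2) => z.
  by rewrite /win; case: (_ && _); rewrite ?expr1n ?expr0n.
apply: (le_trans (Ex_le_mean_dev pP2 v_ge0 Q_var win2)); rewrite lerD2r.
apply: ler_pM => //.
- by apply: (Ex_ge0 pP2); exact: Q_ge0.
- by apply: (Ex_ge0 pP2).
by rewrite /win (Ex2_fst pP (fun x => ((u 0 < W x) && (W x <= u (M + 4)))%R%:R)) Ex_window.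
Qed.

End Average.

Lemma std_cdf_mono s t : s <= t -> std_cdf s <= std_cdf t.
Proof.
move=> st; apply: (Ex_le pP) => x.
by case: (lerP (W x) s) => // /le_trans /(_ st) ->.
Qed.

(** Monotonicity of the distribution function compares t with lattice points to its right for the
    upper bound and to its left for the lower one; [Phi] moves by at most (M + 1) / (2 sigma) over
    them. *)
Lemma kolmogorov_step M t : (0 < M)%N ->
  `|std_cdf t - Phi t| <=
  v / sigma ^+ 2 + (160 * a + 2 * v) / sigma ^+ 3
  + 8 / sigma ^+ 2 * (16 * a * (2 * kappa + (M + 4)%:R / (2 * sigma)) + v) / M%:R
  + (M + 1)%:R / (2 * sigma).
Proof.
move=> M0; have M0' : 0 < M%:R :> R by rewrite ltr0n.
set A := 8 / _ * _.
rewrite -lerBlDr -(ler_pM2l M0').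
have -> : M%:R * (v / sigma ^+ 2 + (160 * a + 2 * v) / sigma ^+ 3 + A / M%:R) =
  M%:R * (v / sigma ^+ 2) + M%:R * ((160 * a + 2 * v) / sigma ^+ 3) + A.
  by field; rewrite sigma_neq0 gt_eqF.
rewrite mulrBr lerBlDr.
have cst (c : R) : \sum_(j < M) c = M%:R * c by rewrite sumr_const card_ord mulr_natl.
have up : M%:R * (std_cdf t - Phi t - (M + 1)%:R / (2 * sigma)) <=
    \sum_(j < M) (std_cdf (t + (j + 2)%:R / sigma) - Phi (t + (j + 2)%:R / sigma)).
  rewrite -cst; apply: ler_sum => j _.
  have le1 : t <= t + (j + 2)%:R / sigma by rewrite lerDl divr_ge0 // ltW.
  have := std_cdf_mono le1; have := Phi_lip le1; rewrite [_ - t]addrC addKr.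
  have : (j + 2)%:R / sigma / 2 <= (M + 1)%:R / (2 * sigma).
    rewrite -mulrA -invfM [_ * 2]mulrC ler_pM2r ?invr_gt0 ?mulr_gt0 // ler_nat.
    by rewrite addn2 addn1 ltnS.
  lra.
(* The starting point is chosen so that the last lattice point, j = M - 1, is t itself. *)
have dn : \sum_(j < M) (std_cdf (t - (M + 1)%:R / sigma + (j + 2)%:R / sigma)
       - Phi (t - (M + 1)%:R / sigma + (j + 2)%:R / sigma))
    <= M%:R * (std_cdf t - Phi t + (M + 1)%:R / (2 * sigma)).
  rewrite -cst; apply: ler_sum => j _.
  have jM : (j + 2)%:R / sigma <= (M + 1)%:R / sigma.
    by rewrite ler_pM2r ?invr_gt0 // ler_nat addn2 addn1 ltnS.
  have j0 : 0 <= (j + 2)%:R / sigma by rewrite divr_ge0 // ltW.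
  have -> : (M + 1)%:R / (2 * sigma) = ((M + 1)%:R / sigma) / 2.
    by field; exact: sigma_neq0.
  move: jM j0; set A1 := (M + 1)%:R / sigma; set B1 := (j + 2)%:R / sigma => jM j0.
  have le1 : t - A1 + B1 <= t by lra.
  have := std_cdf_mono le1; have := Phi_lip le1; lra.
have := average_le t M; have := average_le (t - (M + 1)%:R / sigma) M.
rewrite !ler_norml -/A => /andP[a1 _] /andP[_ a2].
move: up dn a1 a2; set X := \sum_(j < M) _; set Z := \sum_(j < M) _.
set C := (M + 1)%:R / (2 * sigma); move: (std_cdf t - Phi t) => D.
by move=> *; case: (ger0P D) => _; lra.
Qed.

End SteinBound.

Require Import Defs.
From mathcomp Require Import all_boot all_order all_algebra.
From mathcomp Require Import all_classical all_reals all_analysis.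
From mathcomp Require Import ring lra.

Unset Implicit Arguments.
Set Strict Implicit.
Import Order.TTheory GRing.Theory Num.Theory.
Import numFieldNormedType.Exports.
Local Open Scope classical_set_scope.
Local Open Scope ring_scope.

(** * The normal distribution function *)

(** Under [normal_prob] the identity has the normal law, so the limits at infinity of the
    distribution function of a random variable become those of [std_normal_cdf]. *)
Definition id_rv (R : realType) : measurableTypeR R -> R := idfun.

HB.instance Definition _ (R : realType) :=
  @isMeasurableFun.Build _ _ _ _ (@id_rv R) (@measurable_id _ _ setT).

Section Gaussian.
Variable R : realType.
Implicit Types (x y s w : R).

Definition gauss_density (x : R) : R := (Num.sqrt (2 * pi))^-1 * expR (- (x ^+ 2) / 2).
Local Notation phi := gauss_density.
Local Notation Phi := (@std_normal_cdf R).

Lemma normal_pdf01 : normal_pdf (0 : R) 1 = phi.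
Proof.
rewrite normal_pdfE ?oner_eq0 //; apply/funext => x.
rewrite /normal_peak /normal_fun /gauss_density subr0 expr1n mul1r.
by rewrite -(mulr_natl pi).
Qed.

Lemma is_derive_cdf x : is_derive x 1 Phi (phi x).
Proof.
have xx : x < x + 1 by rewrite ltrDl.
have int : lebesgue_measure.-integrable [set` `]-oo, x + 1]%R]
    (EFin \o normal_pdf (0 : R) 1).
  exact: integrableS (integrable_normal_pdf 0 1).
have [dF F'] := continuous_FTC1 xx int (ltNyr _)
  (@continuous_normal_pdf R 0 1 (oner_neq0 R) x).
apply: DeriveDef; first exact: dF.
by rewrite -derive1E F' normal_pdf01.
Qed.

Lemma phi_gt0 x : 0 < phi x.
Proof. by rewrite mulr_gt0 ?expR_gt0 // invr_gt0 sqrtr_gt0 mulr_gt0 ?pi_gt0. Qed.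

Lemma is_derive_density x : is_derive x 1 phi (- x * phi x).
Proof.
rewrite /gauss_density.
have h : is_derive x 1 (fun y : R => - (y ^+ 2) / 2) (- x).
  by apply: is_derive_eq; rewrite /GRing.scale /=; field.
by apply: is_derive_eq; rewrite /GRing.scale /=; ring.
Qed.

Lemma cdf_ge0 x : 0 <= Phi x.
Proof. by apply: fine_ge0. Qed.

Lemma cdf_le1 x : Phi x <= 1.
Proof.
have -> : 1 = fine (1%E : \bar R) by [].
by rewrite /std_normal_cdf fine_le ?fin_num_measure //; exact: probability_le1.
Qed.

Lemma cdf_near1 w e : 0 < e -> exists2 b : R, w < b & 1 - Phi b < e.
Proof.
move=> e0.
have /fine_cvg h := @cvg_cdfy1 _ (measurableTypeR R) R (normal_prob 0 1) (@id_rv R).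
have lt1 : 1 - e < fine (1 : \bar R) by rewrite /= ltrBlDr ltrDl.
have [b [h1 h2]] := filter_ex (filterI (nbhs_pinfty_gt (num_real w)) (cvgr_gt _ h _ lt1)).
by exists b => //; rewrite ltrBlDr -ltrBlDl; exact: h2.
Qed.

Lemma cdf_near0 w e : 0 < e -> exists2 b : R, b < w & Phi b < e.
Proof.
move=> e0.
have /fine_cvg h := @cvg_cdfNy0 _ (measurableTypeR R) R (normal_prob 0 1) (@id_rv R).
have lt1 : fine (0 : \bar R) < e by [].
have [b [h1 h2]] := filter_ex (filterI (nbhs_ninfty_lt (num_real w)) (cvgr_lt _ h _ lt1)).
by exists b.
Qed.

(** Stated for both orders of the endpoints, since a ball may move W either way. *)
Lemma mvt (g dg : R -> R) (a b : R) : (forall x, is_derive x 1 g (dg x)) ->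
  exists c, [/\ `|c - a| <= `|b - a|, Num.min a b <= c, c <= Num.max a b
    & g b - g a = dg c * (b - a)].
Proof.
move=> gd.
have cont (u v : R) : {within `[u, v], continuous g}.
  apply: continuous_subspaceT => x; apply: differentiable_continuous.
  by apply/derivable1_diffP; have [] := gd x.
have [ab|/ltW ba] := leP a b.
  have [c /itvP cab ->] := MVT_segment ab (fun x _ => gd x) (cont a b).
  exists c; split=> //; rewrite ?cab //.
  by rewrite !ger0_norm ?subr_ge0 ?cab // lerB ?cab.
have [c /itvP cab E] := MVT_segment ba (fun x _ => gd x) (cont b a).
exists c; split; rewrite ?cab //.
  by rewrite !ler0_norm ?subr_le0 ?cab // !opprB lerB ?cab.
by rewrite -[g b - g a]opprB E -mulrN opprB.
Qed.

Lemma ge0_derive_homo (g dg : R -> R) (a b : R) :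
  (forall x, is_derive x 1 g (dg x)) -> a <= b ->
  (forall c, a <= c <= b -> 0 <= dg c) -> g a <= g b.
Proof.
move=> gd ab dg0; have [c [_ + +]] := mvt g dg a b gd.
rewrite minEle maxEle ab => ac cb E.
by rewrite -subr_ge0 E mulr_ge0 ?subr_ge0 // dg0 // ac cb.
Qed.

Lemma density_le x : phi x <= 1 / 2.
Proof.
have s2 : 2 <= Num.sqrt (2 * pi) :> R.
  rewrite -[leLHS]ger0_norm // -sqrtr_sqr.
  by apply: ler_wsqrtr; rewrite expr2 ler_pM2l // pi_ge2.
rewrite /gauss_density -[1 / 2]mulr1; apply: ler_pM; rewrite ?invr_ge0 ?sqrtr_ge0 ?expR_ge0 //.
  by rewrite div1r lef_pV2 ?posrE //; exact: lt_le_trans s2.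
rewrite -[leRHS]expR0 ler_expR; have := sqr_ge0 x; lra.
Qed.

Lemma cdf_lip s t : s <= t -> 0 <= Phi t - Phi s <= (t - s) / 2.
Proof.
move=> st; have [c [_ _ _ ->]] := mvt Phi phi s t is_derive_cdf.
have t0 : 0 <= t - s by rewrite subr_ge0.
have := density_le c; have := ltW (phi_gt0 c); nra.
Qed.

Lemma cdf_mono s t : s <= t -> Phi s <= Phi t.
Proof. by move=> /cdf_lip /andP[]; rewrite subr_ge0. Qed.

Lemma mills_up w : w * (1 - Phi w) <= phi w.
Proof.
have [w0|w0] := leP w 0.
  apply: le_trans (ltW (phi_gt0 w)); rewrite mulr_le0_ge0 // subr_ge0.
  exact: cdf_le1.
apply/ler_addgt0Pr => e e0.
have ew : 0 < e / w by rewrite divr_gt0.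
have [b wb hb] := cdf_near1 w _ ew.
(* The derivative (x - w) phi x is nonnegative to the right of w; comparing w with a far point b,
   where 1 - Phi b < e / w, gives the Mills bound. *)
have gd x : is_derive x 1 (fun y => - phi y - w * Phi y) (x * phi x - w * phi x).
  have := is_derive_density x; have := is_derive_cdf x => ? ?.
  by apply: is_derive_eq; rewrite /GRing.scale /=; ring.
have h : - phi w - w * Phi w <= - phi b - w * Phi b.
  apply: (ge0_derive_homo _ _ w b gd (ltW wb)) => c /andP[wc _].
  by rewrite -mulrBl mulr_ge0 ?subr_ge0 // ltW ?phi_gt0.
have := phi_gt0 b.
have : w * (1 - Phi b) < e by rewrite mulrC -ltr_pdivlMr.
lra.
Qed.

Lemma mills_dn w : - w * Phi w <= phi w.
Proof.
have [w0|w0] := leP 0 w.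
  apply: le_trans (ltW (phi_gt0 w)); rewrite mulNr oppr_le0 mulr_ge0 //.
  exact: cdf_ge0.
apply/ler_addgt0Pr => e e0.
have ew : 0 < e / - w by rewrite divr_gt0 // oppr_gt0.
have [b bw hb] := cdf_near0 w _ ew.
have gd x : is_derive x 1 (fun y => phi y + w * Phi y) (- x * phi x + w * phi x).
  have := is_derive_density x; have := is_derive_cdf x => ? ?.
  by apply: is_derive_eq; rewrite /GRing.scale /=; ring.
have h : phi b + w * Phi b <= phi w + w * Phi w.
  apply: (ge0_derive_homo _ _ b w gd (ltW bw)) => c /andP[_ cw].
  by rewrite -mulrDl mulr_ge0 ?(ltW (phi_gt0 _)) // addrC subr_ge0.
have := phi_gt0 b.
have : - w * Phi b < e by rewrite mulrC -ltr_pdivlMr // oppr_gt0.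
lra.
Qed.

End Gaussian.

(** * Solution of the Stein equation and its bounds *)

Section SteinEquation.
Variable R : realType.
Implicit Types (x y s w : R).
Local Notation phi := (@gauss_density R).
Local Notation Phi := (@std_normal_cdf R).

(** The reciprocal of the normal density, that is, the integrating factor of the Stein equation. *)
Definition inv_density (x : R) : R := Num.sqrt (2 * pi) * expR (x ^+ 2 / 2).
Local Notation psi := inv_density.

Lemma inv_density_gt0 x : 0 < psi x.
Proof. by rewrite mulr_gt0 ?expR_gt0 // sqrtr_gt0 mulr_gt0 ?pi_gt0. Qed.

Lemma inv_densityK x : phi x * psi x = 1.
Proof.
rewrite /gauss_density /inv_density mulrACA mulVf; last first.
  by rewrite gt_eqF // sqrtr_gt0 mulr_gt0 ?pi_gt0.
by rewrite mulNr expRN mulVf ?mulr1 // gt_eqF // expR_gt0.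
Qed.

Lemma is_derive_inv_density x : is_derive x 1 psi (x * psi x).
Proof.
rewrite /inv_density.
have h : is_derive x 1 (fun y : R => (y ^+ 2) / 2) x.
  by apply: is_derive_eq; rewrite /GRing.scale /=; field.
by apply: is_derive_eq; rewrite /GRing.scale /=; ring.
Qed.

Lemma inv_density_le x : `|x| <= 1 -> psi x <= 6.
Proof.
move=> x1; rewrite /inv_density (_ : 6 = 3 * 2); last by ring.
apply: ler_pM; rewrite ?sqrtr_ge0 ?expR_ge0 //.
  rewrite -[leRHS]ger0_norm // -sqrtr_sqr; apply: ler_wsqrtr.
  by have := @pihalf_lt2 R; rewrite expr2; lra.
have x2 : x ^+ 2 <= 1 by rewrite -real_normK ?num_real // expr_le1.
apply: (@le_trans _ _ (expR (1 / 2))); first by rewrite ler_expR; lra.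
rewrite -[leRHS]invrK -[leLHS]invrK lef_pV2 ?posrE ?invr_gt0 ?expR_gt0 //.
by rewrite -expRN; apply: le_trans (expR_ge1Dx _); lra.
Qed.

Lemma mills_up_inv w : w * psi w * (1 - Phi w) <= 1.
Proof.
have := mills_up R w; rewrite -(ler_pM2r (inv_density_gt0 w)) inv_densityK.
by apply: le_trans; rewrite mulrAC.
Qed.

Lemma mills_dn_inv w : - (w * psi w) * Phi w <= 1.
Proof.
have := mills_dn R w; rewrite -(ler_pM2r (inv_density_gt0 w)) inv_densityK.
by apply: le_trans; rewrite mulrAC !mulNr.
Qed.

Definition sol_left s w : R := (1 - Phi s) * (Phi w * psi w).
Definition sol_right s w : R := Phi s * ((1 - Phi w) * psi w).
Definition stein_sol s w : R := if w <= s then sol_left s w else sol_right s w.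

Lemma is_derive_sol_left s w :
  is_derive w 1 (sol_left s) (w * sol_left s w + (1 - Phi s)).
Proof.
have := is_derive_inv_density w; have := is_derive_cdf R w => ? ?.
rewrite /sol_left; apply: is_derive_eq; rewrite /GRing.scale /=.
transitivity (w * ((1 - Phi s) * (Phi w * psi w)) + (1 - Phi s) * (phi w * psi w)).
  by ring.
by rewrite inv_densityK mulr1.
Qed.

Lemma is_derive_sol_right s w :
  is_derive w 1 (sol_right s) (w * sol_right s w + - Phi s).
Proof.
have := is_derive_inv_density w; have := is_derive_cdf R w => ? ?.
rewrite /sol_right; apply: is_derive_eq; rewrite /GRing.scale /=.
transitivity (w * (Phi s * ((1 - Phi w) * psi w)) + - Phi s * (phi w * psi w)).
  by ring.
by rewrite inv_densityK mulr1.
Qed.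

(** For w <= s the product (1 - Phi s) Phi w is at most both Phi w and 1 - Phi w, so the Mills bound
    on the side given by the sign of w applies. *)
Lemma sol_left_abs s w : w <= s -> `|w * sol_left s w| <= 1.
Proof.
move=> ws; rewrite /sol_left.
have F0 := cdf_ge0 R w; have F1 := cdf_le1 R w; have FG := cdf_mono R w s ws.
have G1 := cdf_le1 R s; have m1 := mills_up_inv w; have m2 := mills_dn_inv w.
have -> : w * ((1 - Phi s) * (Phi w * psi w)) =
   (w * psi w) * ((1 - Phi s) * Phi w) by ring.
move: (w * psi w) m1 m2 => u m1 m2.
move: (Phi w) (Phi s) F0 F1 FG G1 m1 m2 => F G F0 F1 FG G1 m1 m2.
rewrite ler_norml; have [u0|u0] := leP 0 u.
  have h : 0 <= (1 - G) * F <= 1 - F by apply/andP; split; nra.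
  by apply/andP; split; nra.
have h : 0 <= (1 - G) * F <= F by apply/andP; split; nra.
by apply/andP; split; nra.
Qed.

Lemma sol_right_abs s w : s <= w -> `|w * sol_right s w| <= 1.
Proof.
move=> sw; rewrite /sol_right.
have F1 := cdf_le1 R w; have FG := cdf_mono R s w sw.
have G0 := cdf_ge0 R s; have m1 := mills_up_inv w; have m2 := mills_dn_inv w.
have -> : w * (Phi s * ((1 - Phi w) * psi w)) =
   (w * psi w) * (Phi s * (1 - Phi w)) by ring.
move: (w * psi w) m1 m2 => u m1 m2.
move: (Phi w) (Phi s) F1 FG G0 m1 m2 => F G F1 FG G0 m1 m2.
rewrite ler_norml; have [u0|u0] := leP 0 u.
  have h : 0 <= G * (1 - F) <= 1 - F by apply/andP; split; nra.
  by apply/andP; split; nra.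
have h : 0 <= G * (1 - F) <= F by apply/andP; split; nra.
by apply/andP; split; nra.
Qed.

(** Outside [-1, 1] the bound on w g gives |g| <= 1; inside, sqrt(2 pi) <= 3 and exp(1/2) <= 2 give
    6. *)
Lemma abs_le6 w (g : R) : `|w * g| <= 1 -> `|g| <= psi w -> `|g| <= 6.
Proof.
move=> h1 h2; have [w1|w1] := leP `|w| 1.
  exact: le_trans h2 (inv_density_le _ w1).
move: h1; rewrite normrM => h1; have := normr_ge0 g; nra.
Qed.

Lemma sol_left_le s w : w <= s -> `|sol_left s w| <= 6.
Proof.
move=> ws; apply: (@abs_le6 w); first exact: sol_left_abs.
rewrite /sol_left; have := cdf_ge0 R w; have := cdf_le1 R w.
have := cdf_ge0 R s; have := cdf_le1 R s; have := inv_density_gt0 w.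
move: (Phi w) (Phi s) (psi w) => F G u u0 G1 G0 F1 F0.
have h : 0 <= (1 - G) * F <= 1 by apply/andP; split; nra.
by rewrite mulrA ger0_norm; nra.
Qed.

Lemma sol_right_le s w : s <= w -> `|sol_right s w| <= 6.
Proof.
move=> ws; apply: (@abs_le6 w); first exact: sol_right_abs.
rewrite /sol_right; have := cdf_ge0 R w; have := cdf_le1 R w.
have := cdf_ge0 R s; have := cdf_le1 R s; have := inv_density_gt0 w.
move: (Phi w) (Phi s) (psi w) => F G u u0 G1 G0 F1 F0.
have h : 0 <= G * (1 - F) <= 1 by apply/andP; split; nra.
by rewrite mulrA ger0_norm; nra.
Qed.

(** Two mean value steps: the equation expresses g' through x g(x), and the derivative of x g(x) is
    at most 6 + 2 (|w| + 1) = 8 + 2 |w|. *)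
Lemma taylor_smooth (g : R -> R) (c w w' : R) :
  (forall x, is_derive x 1 g (x * g x + c)) ->
  (forall x, Num.min w w' <= x <= Num.max w w' ->
     `|g x| <= 6 /\ `|x * g x + c| <= 2) ->
  `|w' - w| <= 1 ->
  `|g w' - g w - (w' - w) * (w * g w + c)| <= (w' - w) ^+ 2 * (8 + 2 * `|w|).
Proof.
move=> gd gb w1.
have [xi [xi1 xi2 xi3 ->]] := mvt R g _ w w' gd.
have hd x : is_derive x 1 (fun y => y * g y) (g x + x * (x * g x + c)).
  by have := gd x => ?; apply: is_derive_eq; rewrite /GRing.scale /=; ring.
have [eta [eta1 eta2 eta3 E]] := mvt R _ _ w xi hd.
have -> : (xi * g xi + c) * (w' - w) - (w' - w) * (w * g w + c) =
  (w' - w) * (xi * g xi - w * g w) by ring.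
rewrite E normrM normrM.
have etab : Num.min w w' <= eta <= Num.max w w'.
  move: eta2 eta3 xi2 xi3; rewrite !minEle !maxEle.
  by case: (leP w xi) => ?; case: (leP w w') => ? ? ? ? ?; apply/andP; split; lra.
have [b1 b2] := gb _ etab.
have etaw : `|eta| <= `|w| + 1.
  have -> : eta = w + (eta - w) by ring.
  apply: (le_trans (ler_normD _ _)); rewrite lerD2l.
  exact: le_trans eta1 (le_trans xi1 w1).
have b3 : `|g eta + eta * (eta * g eta + c)| <= 8 + 2 * `|w|.
  apply: (le_trans (ler_normD _ _)); rewrite normrM.
  have := normr_ge0 eta; have := normr_ge0 (eta * g eta + c); nra.
rewrite -[(w' - w) ^+ 2]real_normK ?num_real // expr2 -!mulrA.
apply: ler_wpM2l => //; rewrite mulrC; apply: ler_pM => //.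
Qed.

Lemma lipschitz_sol (g : R -> R) (c w w' : R) :
  (forall x, is_derive x 1 g (x * g x + c)) ->
  (forall x, Num.min w w' <= x <= Num.max w w' -> `|x * g x + c| <= 2) ->
  `|g w' - g w| <= 2 * `|w' - w|.
Proof.
move=> gd gb; have [xi [_ xi2 xi3 ->]] := mvt R g _ w w' gd.
by rewrite normrM ler_wpM2r // gb // xi2 xi3.
Qed.

Lemma sol_left_deriv_le s w : w <= s -> `|w * sol_left s w + (1 - Phi s)| <= 2.
Proof.
move=> /sol_left_abs; have := cdf_ge0 R s; have := cdf_le1 R s.
by rewrite !ler_norml => ? ? /andP[? ?]; apply/andP; split; lra.
Qed.

Lemma sol_right_deriv_le s w : s <= w -> `|w * sol_right s w + - Phi s| <= 2.
Proof.
move=> /sol_right_abs; have := cdf_ge0 R s; have := cdf_le1 R s.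
by rewrite !ler_norml => ? ? /andP[? ?]; apply/andP; split; lra.
Qed.

Lemma sol_leftE s w : w <= s -> stein_sol s w = sol_left s w.
Proof. by rewrite /stein_sol => ->. Qed.

Lemma sol_rightE s w : s <= w -> stein_sol s w = sol_right s w.
Proof.
rewrite /stein_sol le_eqVlt => /predU1P[<-|sw]; last by rewrite leNgt sw.
by rewrite lexx /sol_left /sol_right; ring.
Qed.

Definition stein_slope s w : R := w * stein_sol s w + (w <= s)%R%:R - Phi s.

Lemma stein_slope_left s w : w <= s ->
  stein_slope s w = w * sol_left s w + (1 - Phi s).
Proof. by move=> ws; rewrite /stein_slope sol_leftE // ws addrA. Qed.

Lemma stein_slope_right s w : s < w ->
  stein_slope s w = w * sol_right s w + - Phi s.
Proof.
by move=> sw; rewrite /stein_slope sol_rightE ?(ltW sw) // leNgt sw addr0.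
Qed.

Lemma stein_slope_le s w : `|stein_slope s w| <= 2.
Proof.
have [ws|sw] := leP w s.
  by rewrite stein_slope_left //; exact: sol_left_deriv_le.
by rewrite stein_slope_right //; exact/sol_right_deriv_le/ltW.
Qed.

Lemma stein_sol_lip s w w' : w <= w' ->
  `|stein_sol s w' - stein_sol s w| <= 2 * `|w' - w|.
Proof.
move=> ww'.
have left x y : x <= y -> y <= s -> `|stein_sol s y - stein_sol s x| <= 2 * `|y - x|.
  move=> xy ys; rewrite !sol_leftE ?(le_trans xy) //.
  apply: (lipschitz_sol _ _ _ _ (is_derive_sol_left s)) => z.
  rewrite minEle maxEle xy => /andP[_ zy].
  by apply: sol_left_deriv_le; exact: le_trans ys.
have right x y : x <= y -> s <= x -> `|stein_sol s y - stein_sol s x| <= 2 * `|y - x|.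
  move=> xy sx; rewrite !sol_rightE ?(le_trans sx) //.
  apply: (lipschitz_sol _ _ _ _ (is_derive_sol_right s)) => z.
  rewrite minEle maxEle xy => /andP[xz _].
  by apply: sol_right_deriv_le; exact: le_trans xz.
have [ws|/ltW sw] := leP w' s; first exact: left.
have [ws|/ltW sw'] := leP w s; last exact: right.
have -> : stein_sol s w' - stein_sol s w =
  (stein_sol s w' - stein_sol s s) + (stein_sol s s - stein_sol s w) by ring.
apply: (le_trans (ler_normD _ _)).
have := right _ _ sw (lexx s); have := left _ _ ws (lexx s).
rewrite (ger0_norm (_ : 0 <= w' - s)) ?subr_ge0 //.
rewrite (ger0_norm (_ : 0 <= s - w)) ?subr_ge0 //.
by rewrite (ger0_norm (_ : 0 <= w' - w)) ?subr_ge0 //; lra.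
Qed.

(** On one side of s the solution is smooth. Across s only its Lipschitz constant 2 and the slope
    bound 2 are available, whence the jump term with factor 4. *)
Lemma stein_taylor s w w' : `|w' - w| <= 1 ->
  `|stein_sol s w' - stein_sol s w - (w' - w) * stein_slope s w| <=
  (w' - w) ^+ 2 * (8 + 2 * `|w|)
  + 4 * `|w' - w| * ((w <= s) != (w' <= s))%R%:R.
Proof.
move=> w1.
have cross : `|stein_sol s w' - stein_sol s w - (w' - w) * stein_slope s w| <=
    4 * `|w' - w|.
  apply: (le_trans (ler_normB _ _)).
  have : `|stein_sol s w' - stein_sol s w| <= 2 * `|w' - w|.
    have [|/ltW] := leP w w'; first exact: stein_sol_lip.
    by move=> /(stein_sol_lip s); rewrite distrC [`|w - _|]distrC.
  have : `|(w' - w) * stein_slope s w| <= 2 * `|w' - w|.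
    by rewrite normrM mulrC ler_wpM2r // stein_slope_le.
  lra.
have sq : 0 <= (w' - w) ^+ 2 * (8 + 2 * `|w|).
  by rewrite mulr_ge0 ?sqr_ge0 // addr_ge0 // mulr_ge0.
case: (leP w s) => ws; case: (leP w' s) => ws' /=; rewrite ?mulr0 ?mulr1 ?addr0.
- rewrite !sol_leftE // stein_slope_left //.
  apply: taylor_smooth (is_derive_sol_left s) _ w1 => x /andP[_ xm].
  have xs : x <= s by apply: (le_trans xm); rewrite ge_max ws ws'.
  by split; [exact: sol_left_le|exact: sol_left_deriv_le].
- by apply: (le_trans cross); rewrite lerDr.
- by apply: (le_trans cross); rewrite lerDr.
- rewrite !sol_rightE ?(ltW ws) ?(ltW ws') // stein_slope_right //.
  apply: taylor_smooth (is_derive_sol_right s) _ w1 => x /andP[xm _].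
  have xs : s <= x by apply: le_trans xm; rewrite le_min !ltW.
  by split; [exact: sol_right_le|exact: sol_right_deriv_le].
Qed.

End SteinEquation.

(** * Normal increments over intervals containing 0 *)

Section GaussianIncrements.
Variable R : realType.
Implicit Types (x y a b : R).
Local Notation phi := (@gauss_density R).
Local Notation Phi := (@std_normal_cdf R).

(** Taylor bounds for sine and cosine, each derived from the preceding one, give cos(8/5) < 0, so pi
    / 2 <= 8/5. *)
Lemma pi_le_16_5 : pi <= 16 / 5 :> R.
Proof.
have sin_le x : 0 <= x -> sin x <= x.
  move=> x0; rewrite -subr_ge0.
  have gd y : is_derive y 1 (fun z => z - sin z) (1 - cos y).
    by apply: is_derive_eq; rewrite /GRing.scale /=; ring.
  have := ge0_derive_homo R _ _ 0 x gd x0; rewrite sin0 subrr; apply.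
  by move=> c _; rewrite subr_ge0 cos_le1.
have cos_ge x : 0 <= x -> 1 - x ^+ 2 / 2 <= cos x.
  move=> x0; rewrite -subr_ge0.
  have gd y : is_derive y 1 (fun z => cos z - (1 - z ^+ 2 / 2)) (y - sin y).
    by apply: is_derive_eq; rewrite /GRing.scale /=; field.
  have := ge0_derive_homo R _ _ 0 x gd x0.
  rewrite cos0 expr0n mul0r subr0 subrr; apply.
  by move=> c /andP[c0 _]; rewrite subr_ge0 sin_le.
have sin_ge x : 0 <= x -> x - x ^+ 3 / 6 <= sin x.
  move=> x0; rewrite -subr_ge0.
  have gd y : is_derive y 1 (fun z => sin z - (z - z ^+ 3 / 6))
      (cos y - (1 - y ^+ 2 / 2)).
    by apply: is_derive_eq; rewrite /GRing.scale /=; field.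
  have := ge0_derive_homo R _ _ 0 x gd x0.
  rewrite sin0 expr0n mul0r !subrr; apply.
  by move=> c /andP[c0 _]; rewrite subr_ge0 cos_ge.
have cos_le x : 0 <= x -> cos x <= 1 - x ^+ 2 / 2 + x ^+ 4 / 24.
  move=> x0; rewrite -subr_ge0.
  have gd y : is_derive y 1 (fun z => 1 - z ^+ 2 / 2 + z ^+ 4 / 24 - cos z)
      (sin y - (y - y ^+ 3 / 6)).
    by apply: is_derive_eq; rewrite /GRing.scale /=; field.
  have := ge0_derive_homo R _ _ 0 x gd x0.
  rewrite cos0 !expr0n !mul0r subr0 addr0 subrr; apply.
  by move=> c /andP[c0 _]; rewrite subr_ge0 sin_ge.
rewrite leNgt; apply/negP => pi16.
have : 0 < cos (8 / 5 : R) by apply: cos_gt0_pihalf; apply/andP; split; lra.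
have /cos_le : 0 <= 8 / 5 :> R by lra.
have -> : 1 - (8 / 5) ^+ 2 / 2 + (8 / 5) ^+ 4 / 24 = - 13 / 1875 :> R by field.
lra.
Qed.

Lemma cdf_increment_small a b : a <= 0 -> 0 <= b -> b - a <= 1 ->
  (b - a) * phi 1 <= Phi b - Phi a.
Proof.
move=> a0 b0 ab; have [c [_ c1 c2 ->]] := mvt R Phi phi a b (is_derive_cdf R).
rewrite mulrC ler_wpM2r //; first by lra.
move: c1 c2; rewrite minEle maxEle (le_trans a0 b0) => c1 c2.
rewrite ler_pM2l ?invr_gt0 ?sqrtr_gt0 ?mulr_gt0 ?pi_gt0 // ler_expR; nra.
Qed.

Lemma density1E : phi 1 = 2 * (Num.sqrt (8 * pi * expR 1))^-1.
Proof.
have p0 := @pi_gt0 R.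
have -> : 8 * pi * expR 1 = (2 * expR (1 / 2)) ^+ 2 * (2 * pi) :> R.
  rewrite exprMn -[expR (1 / 2) ^+ 2]expRM_natr.
  have -> : 1 / 2 * 2%:R = 1 :> R by field.
  ring.
rewrite sqrtrM ?sqr_ge0 // sqrtr_sqr ger0_norm; last first.
  by rewrite mulr_ge0 // expR_ge0.
rewrite /gauss_density expr1n mulNr expRN !invfM; field.
by rewrite !gt_eqF ?sqrtr_gt0 ?mulr_gt0 ?expR_gt0.
Qed.

Lemma cdf_increment_large a b : a <= 0 -> 0 <= b -> 1 <= b - a ->
  1 / 3 <= Phi b - Phi a.
Proof.
move=> a0 b0 ab.
(* The antiderivative of (1 - x^2/4)^2, which bounds exp(- x^2/2) from below. Its least increment
   over a unit interval containing 0 is 203/240, and dividing by 38/15 >= sqrt(2 pi) still leaves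
   more than 1/3. *)
pose g x := x - x ^+ 3 / 6 + x ^+ 5 / 80.
have unit u : - 1 <= u -> u <= 0 -> 1 / 3 <= Phi (u + 1) - Phi u.
  move=> u1 u0; pose c : R := (Num.sqrt (2 * pi))^-1.
  have c0 : 0 < c by rewrite invr_gt0 sqrtr_gt0 mulr_gt0 ?pi_gt0.
  have gd y : is_derive y 1 (fun z => Phi z - c * g z)
      (phi y - c * (1 - y ^+ 2 / 4) ^+ 2).
    have := is_derive_cdf R y => ?; rewrite /g.
    by apply: is_derive_eq; rewrite /GRing.scale /=; field.
  have uu : u <= u + 1 by rewrite lerDl.
  have : c * (g (u + 1) - g u) <= Phi (u + 1) - Phi u.
    suff : Phi u - c * g u <= Phi (u + 1) - c * g (u + 1) by lra.
    apply: (ge0_derive_homo R _ _ u (u + 1) gd uu) => y /andP[y1 y2].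
    rewrite subr_ge0 ler_pM2l //.
    have y4 : 0 <= 1 - y ^+ 2 / 4 by nra.
    have -> : - y ^+ 2 / 2 = - (y ^+ 2 / 4) * 2%:R by field.
    rewrite expRM_natr lerXn2r ?nnegrE ?expR_ge0 //.
    exact: expR_ge1Dx.
  apply: le_trans.
  have g1 : 203 / 240 <= g (u + 1) - g u.
    pose t : R := - u * (u + 1); have t0 : 0 <= t by rewrite mulr_ge0; lra.
    have -> : g (u + 1) - g u = 203 / 240 + 7 / 16 * t + t ^+ 2 / 16.
      by rewrite /g /t; field.
    have := sqr_ge0 t; lra.
  apply: (@le_trans _ _ (c * (203 / 240))); last by rewrite ler_pM2l.
  have sle : Num.sqrt (2 * pi) <= 38 / 15 :> R.
    rewrite -[leRHS]ger0_norm ?divr_ge0 // -sqrtr_sqr; apply: ler_wsqrtr.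
    have := pi_le_16_5; have -> : (38 / 15) ^+ 2 = 1444 / 225 :> R by field.
    lra.
  have s0 : 0 < Num.sqrt (2 * pi) :> R by rewrite sqrtr_gt0 mulr_gt0 ?pi_gt0.
  rewrite /c [leRHS]mulrC ler_pdivlMr //; lra.
have [a1|a1] := leP (- 1) a.
  have := unit a a1 a0; have : Phi (a + 1) <= Phi b by apply: cdf_mono; lra.
  lra.
have := unit (- 1) (lexx _); rewrite lerN10 => /(_ isT).
have : Phi (- 1 + 1) <= Phi b by apply: cdf_mono; lra.
have : Phi a <= Phi (- 1) by apply: cdf_mono; lra.
lra.
Qed.

End GaussianIncrements.

(** * The Kolmogorov distance *)

Section Transfer.
Context (R : realType) (d : measure_display) (T : measurableType d).
Variables (P : probability T R) (n : nat) (S : finType) (p : S -> R).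
Variable X : 'I_n -> T -> S.
Hypothesis X_rv : forall i, discrete_rv (X i).
Hypothesis X_indep : mutually_independent P X.
Hypothesis X_pmf : forall i x, P (X i @^-1` [set x]) = (p x)%:E.

Definition sample (w : T) : {ffun 'I_n -> S} := [ffun i => X i w].

Lemma sample_preimage (z : {ffun 'I_n -> S}) :
  sample @^-1` [set z] = \bigcap_(i in [set` [set: 'I_n]%SET]) X i @^-1` [set z i].
Proof.
apply/seteqP; split => [w /= <- i _|w /= h]; first by rewrite ffunE.
by apply/ffunP => i; rewrite ffunE; apply: h; rewrite /= finset.in_setT.
Qed.

Lemma measurable_sample (z : {ffun 'I_n -> S}) :
  measurable (sample @^-1` [set z]).
Proof.
rewrite sample_preimage; apply: fin_bigcap_measurable; first exact: finite_finset.
by move=> i _; exact: X_rv.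
Qed.

Lemma prob_sample (z : {ffun 'I_n -> S}) :
  P (sample @^-1` [set z]) = (\prod_i p (z i))%:E.
Proof.
rewrite sample_preimage (X_indep _ (fun i => [set z i])).
rewrite (eq_bigr (fun i => (p (z i))%:E)) => [|i _]; last exact: X_pmf.
rewrite prodEFin; congr (_%:E).
by apply: eq_bigl => i; rewrite finset.in_setT.
Qed.

(** The sample takes finitely many values, so the integral splits along its fibres, whose
    probabilities are the product weights. *)
Lemma expectation_sample (F : {ffun 'I_n -> S} -> R) :
  'E_P[fun w => F (sample w)]%E = (Ex p F)%:E.
Proof.
rewrite unlock.
transitivity (\int[P]_w (\sum_(z : {ffun 'I_n -> S})
   (F z)%:E * (\1_(sample @^-1` [set z]) w)%:E))%E.
  apply: eq_integral => w _; rewrite (bigD1 (sample w)) //= big1 ?adde0.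
    by rewrite indicE mem_set //= mule1.
  move=> z /eqP zw; rewrite indicE memNset ?mule0 //= => /esym; exact: zw.
have ind z : P.-integrable setT (fun w => (\1_(sample @^-1` [set z]) w)%:E).
  by apply: integrable_indic; exact: measurable_sample.
rewrite integral_sum //; last by move=> z; exact: integrableZl.
rewrite /Ex -sumEFin; apply: eq_bigr => z _.
rewrite integralZl // integral_indic ?setIT //; last exact: measurable_sample.
by rewrite EFinM muleC; congr (_ * _)%E; exact: prob_sample.
Qed.

Lemma prob_sample_event (Q : {ffun 'I_n -> S} -> bool) :
  fine (P [set w | Q (sample w)]) = Ex p (fun z => (Q z)%:R).
Proof.
have mA : measurable [set w | Q (sample w)].
  have -> : [set w | Q (sample w)] =
      \bigcup_(z in [set z | Q z]) (sample @^-1` [set z]).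
    apply/seteqP; split => w /=; first by move=> Qw; exists (sample w).
    by move=> [z Qz E]; rewrite (E : sample w = z).
  by apply: fin_bigcup_measurable => [|z _]; [exact: finite_finset|exact: measurable_sample].
rewrite -expectation_indic //.
have -> : \1_[set w | Q (sample w)] = (fun w => (Q (sample w))%:R : R).
  by apply/funext => w; rewrite indicE; congr (nat_of_bool _)%:R; apply/idP/idP; rewrite inE.
by rewrite (expectation_sample (fun z => (Q z)%:R)).
Qed.

End Transfer.

(** The summand j = i of [num_companions] cancels the -1. *)
Lemma num_nonisolatedE (R : realType) (n m : nat) (x : 'I_n -> 'I_m) :
  (num_nonisolated x)%:R = @nonisolated R n 'I_m [ffun i => x i].
Proof.
rewrite /num_nonisolated natr_sum; apply: eq_bigr => i _; congr (_%:R).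
congr nat_of_bool; rewrite /num_companions (bigD1 i) //= eqxx addrA addNr add0r.
rewrite /cnt -natr_sum natz ltz_nat; congr (0 < _)%N.
by apply: eq_bigr => j _; rewrite !ffunE.
Qed.

Lemma std_cdf_bounds (R : realType) (n : nat) (S : finType) (p : S -> R) sigma t :
  is_pmf p -> 0 <= @std_cdf R n S p sigma t <= 1.
Proof.
move=> pP; apply/andP; split; first exact: Ex_ge0.
rewrite -(Ex_cst n pP 1); apply: (Ex_le pP) => z; by rewrite lern1 leq_b1.
Qed.

Section Distance.
Variables (R : realType) (n : nat) (S : finType) (p : S -> R).
Hypothesis pP : is_pmf p.
Variable sigma : R.
Hypothesis sigma_gt0 : 0 < sigma.
Local Notation Phi := (@std_normal_cdf R).
Local Notation F := (@std_cdf R n S p sigma).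

Definition kolmogorov_distance : R :=
  sup [set `|F t - Phi t| | t in [set: R]].
Local Notation D := kolmogorov_distance.

Lemma distance_le1 t : `|F t - Phi t| <= 1.
Proof.
have /andP[F0 F1] := std_cdf_bounds R n S p sigma t pP.
by have := cdf_ge0 R t; have := cdf_le1 R t; rewrite ler_norml; lra.
Qed.

Lemma distance_ub t : `|F t - Phi t| <= D.
Proof.
apply: ub_le_sup; last by exists t.
by exists 1 => _ [s _ <-]; exact: distance_le1.
Qed.

Lemma distance_le c : (forall t, `|F t - Phi t| <= c) -> D <= c.
Proof.
move=> h; apply: ge_sup; first by exists `|F 0 - Phi 0|; exists 0.
by move=> _ [t _ <-].
Qed.

(* F is constant on a lattice gap containing 0, so it cannot follow the
   increment of Phi there. *)
Lemma lattice_gap : exists a b : R,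
  [/\ a <= 0, 0 <= b, b - a = sigma^-1 & Phi b - Phi a <= 2 * D].
Proof.
pose mu := Ex p (@nonisolated R n S).
have mu0 : 0 <= mu by apply: Ex_ge0 => // z; exact: sumr_ge0.
pose k := Num.truncn mu.
have /andP[k1 k2] := truncn_itv mu0.
pose a := (k%:R - mu) / sigma; pose b := (k.+1%:R - mu) / sigma.
have ab : b - a = sigma^-1.
  by rewrite /a /b -natr1; field; rewrite gt_eqF.
have a0 : a <= 0 by rewrite mulr_le0_ge0 ?subr_le0 // invr_ge0 ltW.
have b0 : 0 <= b by rewrite divr_ge0 ?subr_ge0 // ltW.
have ab' : a < b by rewrite -subr_gt0 ab invr_gt0.
have const t : a <= t -> t < b -> F t = F a.
  move=> at_ tb; apply: eq_Ex => z; congr (nat_of_bool _)%:R.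
  rewrite /standardized -/mu; apply/idP/idP => [h|h]; last exact: le_trans at_.
  have : (@nonisolated R n S z - mu) / sigma < b by exact: le_lt_trans tb.
  rewrite /nonisolated -natr_sum /a /b !ltr_pM2r ?ler_pM2r ?invr_gt0 //.
  by rewrite ltrBrDr subrK lerBrDr subrK ltr_nat ler_nat ltnS.
exists a, b; split => //; apply/ler_addgt0Pr => e e0.
(* F may jump at b, so Phi is compared with it at a point t < b within e of b. *)
pose t := Num.max a (b - e).
have at_ : a <= t by rewrite le_max lexx.
have tb : t < b by rewrite gt_max ab' ltrBlDr ltrDl.
have bt : b - t <= e by rewrite lerBlDr -lerBlDl le_max lexx orbT.
have := distance_ub t; have := distance_ub a; rewrite (const t) //.
have := cdf_lip R t b (ltW tb).
by rewrite !ler_norml => /andP[? ?] /andP[? ?] /andP[? ?]; lra.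
Qed.

Lemma distance_ge :
  Num.min (1 / 6) ((Num.sqrt (8 * pi * expR 1))^-1 * sigma^-1) <= D.
Proof.
have [a [b [a0 b0 ab gap]]] := lattice_gap.
(* A gap of length at most 1 has density at least phi 1, which is twice the stated constant; a
   longer gap has normal mass at least 1/3. The factor 2 in front of [D] halves both. *)
rewrite ge_min; have [s1|s1] := leP sigma^-1 1.
  apply/orP; right; have := cdf_increment_small R a b a0 b0.
  rewrite ab density1E => /(_ s1); move: gap; set c := (Num.sqrt _)^-1.
  by rewrite mulrCA [c * _]mulrC; lra.
apply/orP; left; have := cdf_increment_large R a b a0 b0.
by rewrite ab => /(_ (ltW s1)); lra.
Qed.

Lemma distance_upper_bound (a v : R) (M : nat) :
  2 <= sigma ->
  sigma ^+ 2 = Ex p (fun x => @nonisolated R n S x ^+ 2)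
               - Ex p (@nonisolated R n S) ^+ 2 ->
  0 <= a -> 0 <= v -> (0 < M)%N ->
  Ex (pmf_pair p) (@qsum R n S (fun t => `|t|)) <= 16 * a ->
  (forall psi : R -> R, (forall x y, `|psi x - psi y| <= `|x - y|) ->
    Ex (pmf_pair p) (fun z => @qsum R n S psi z ^+ 2)
      - Ex (pmf_pair p) (@qsum R n S psi) ^+ 2 <= v ^+ 2) ->
  D <= v / sigma ^+ 2 + (160 * a + 2 * v) / sigma ^+ 3
    + 8 / sigma ^+ 2 * (16 * a * (2 * D + (M + 4)%:R / (2 * sigma)) + v) / M%:R
    + (M + 1)%:R / (2 * sigma).
Proof.
move=> s2 sE a0 v0 M0 Q1 Qv; apply: distance_le => t.
apply: (@kolmogorov_step R n S p pP sigma s2 sE Phi (@stein_sol R)) => //.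
- exact: cdf_lip.
- exact: stein_slope_le.
- exact: stein_taylor.
- by apply: Qv => x y; exact: ler_dist_dist.
- by apply: Qv.
- exact: distance_ub.
Qed.

End Distance.

(** This is the source of 2.1 in the exponent: (1 - p)^(2n) >= exp(- 1.05 * 2 n p). The factor 1.05
    suffices for p up to 1/11. *)
Lemma expR_le_onem (R : realType) (t : R) : 0 <= t -> t <= 1 / 11 ->
  expR (- (21 / 20 * t)) <= 1 - t.
Proof.
move=> t0 t1; rewrite expRN.
have h : 1 + 21 / 20 * t + (21 / 20 * t) ^+ 2 / 2 <= expR (21 / 20 * t).
  have gd (y : R) : is_derive y 1 (fun z : R => expR z - (1 + z + z ^+ 2 / 2))
      (expR y - (1 + y)).
    by apply: is_derive_eq; rewrite /GRing.scale /=; field.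
  have s0 : 0 <= 21 / 20 * t by rewrite mulr_ge0 //; lra.
  have := ge0_derive_homo R _ _ 0 _ gd s0.
  rewrite expR0 expr0n mul0r !addr0 subrr subr_ge0; apply => c _.
  by rewrite subr_ge0 expR_ge1Dx.
rewrite -[leLHS]div1r ler_pdivrMr ?expR_gt0 //.
apply: le_trans (ler_wpM2l _ h); first by nra.
lra.
Qed.

(* If a <= K sigma^2 and v = 96 gamma K sigma, taking M close to 512 K in
   distance_upper_bound makes the coefficient of D at most 1/2. *)
Lemma bootstrap (R : realType) (D a sigma g K : R) (M : nat) :
  2 <= sigma -> 1 <= g -> 1 <= K -> 0 <= a -> a <= K * sigma ^+ 2 -> 0 <= D ->
  512 * K <= M%:R -> M%:R <= 512 * K + 1 ->
  let v := 96 * (g * K * sigma) in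
  D <= v / sigma ^+ 2 + (160 * a + 2 * v) / sigma ^+ 3
    + 8 / sigma ^+ 2 * (16 * a * (2 * D + (M + 4)%:R / (2 * sigma)) + v) / M%:R
    + (M + 1)%:R / (2 * sigma) ->
  D <= 1666 * (g * K / sigma).
Proof.
move=> s2 g1 K1 a0 aK D0 M1 M2 v.
have s0 : 0 < sigma by lra.
have sn0 : sigma != 0 by rewrite gt_eqF.
have M0 : 0 < M%:R :> R by lra.
have Mn0 : M%:R != 0 :> R by rewrite gt_eqF.
set b := a / sigma ^+ 2.
have b0 : 0 <= b by rewrite divr_ge0 ?exprn_ge0 // ltW.
have bK : b <= K by rewrite ler_pdivrMr ?exprn_gt0.
set i := sigma^-1.
have i0 : 0 < i by rewrite invr_gt0.
have i2 : i <= 1 / 2 by rewrite div1r lef_pV2 ?posrE.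
set r := K / M%:R.
have r0 : 0 <= r by rewrite divr_ge0 ?ltW //; lra.
have r1 : r <= 1 / 512 by rewrite ler_pdivrMr //; lra.
have -> : v / sigma ^+ 2 = 96 * (g * K * i) by rewrite /v /i; field.
have -> : (160 * a + 2 * v) / sigma ^+ 3 = 160 * (b * i) + 192 * (g * K * i) * i.
  by rewrite /v /b /i; field.
rewrite !natrD.
have -> : 8 / sigma ^+ 2 * (16 * a * (2 * D + (M%:R + 4%:R) / (2 * sigma)) + v) / M%:R
  = 256 * (b / M%:R) * D + 64 * (b * i) + 256 * (b / M%:R) * i
    + 768 * (g * r * i) by rewrite /v /b /i /r; field; rewrite Mn0 sn0.
have -> : (M%:R + 1%:R) / (2 * sigma) = 1 / 2 * (M%:R * i) + 1 / 2 * i.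
  by rewrite /i; field.
have bM : b / M%:R <= r by rewrite ler_pM2r ?invr_gt0.
have bM0 : 0 <= b / M%:R by rewrite divr_ge0 // ltW.
set q := b / M%:R in bM bM0 *.
clearbody q b r i.
have K0 : 0 <= K by lra.
have g0 : 0 <= g by lra.
have KgK : K <= g * K by rewrite ler_peMl.
have gK : 1 <= g * K by exact: le_trans KgK.
have ggK : g <= g * K by rewrite ler_peMr.
have gr : g * r <= g * (1 / 512) by rewrite ler_wpM2l.
set w := g * K * i.
have w0 : 0 <= w by rewrite mulr_ge0 ?(ltW i0) // mulr_ge0.
have h1 : b * i <= w by rewrite ler_pM2r //; lra.
have h2 : i <= w by rewrite ler_peMl // ltW.
have h3 : w * i <= w * (1 / 2) by rewrite ler_wpM2l.
have q1 : q <= 1 / 512 by lra.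
have h4 : q * D <= 1 / 512 * D by rewrite ler_wpM2r.
have h5 : q * i <= 1 / 512 * i by rewrite ler_wpM2r // ltW.
have h6 : g * r * i <= 1 / 512 * w.
  by rewrite [leRHS]mulrA ler_pM2r //; lra.
have h7 : M%:R * i <= 513 * w.
  by rewrite [leRHS]mulrA ler_pM2r //; lra.
(* The bounds add up to D / 2 + 675 w, so D <= 1350 w. *)
clearbody w; clear - w0 h1 h2 h3 h4 h5 h6 h7.
lra.
Qed.

(** The constant 29 turns n (n - 1) / 28 into n^2 / 29, which is valid exactly from n = 29 on. *)
Lemma variance_nonisolated_ge (R : realType) (n : nat) (S : finType)
    (p : S -> R) (pmax gamma : R) :
  is_pmf p -> (forall x, p x <= pmax) -> pmax <= 1 / 11 ->
  n%:R * pmax <= gamma -> (29 <= n)%N ->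
  n%:R ^+ 2 * \sum_x p x ^+ 2 <= 29 * expR (21 / 10 * gamma) *
    (Ex p (fun z => @nonisolated R n S z ^+ 2) - Ex p (@nonisolated R n S) ^+ 2).
Proof.
move=> pP p_le pm gm n29; set s2 := \sum_x _.
have s2_ge0 : 0 <= s2 by apply: sumr_ge0 => x _; exact: sqr_ge0.
have n0 : (29 : R) <= n%:R by rewrite (ler_nat R 29).
set E := expR _; have E0 : 0 < E by exact: expR_gt0.
have pow x : E^-1 <= (1 - p x) ^+ (2 * n).
  have h := @expR_le_onem R (p x) (pP.1 x) (le_trans (p_le x) pm).
  apply: le_trans (lerXn2r (2 * n) _ _ h); rewrite ?nnegrE ?expR_ge0 //; last first.
    by have := p_le x; lra.
  rewrite -expRM_natr -expRN ler_expR natrM.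
  have : n%:R * p x <= gamma.
    by apply: le_trans gm; rewrite ler_wpM2l.
  lra.
have n4 : (4 <= n)%N by exact: leq_trans n29.
have p11 x : p x <= 1 / 11 by exact: le_trans pm.
have := @variance_ge R n S p pP p11 n4; set V := _ - _ => VE.
rewrite -ler_pdivrMl ?mulr_gt0 //.
apply: le_trans VE.
apply: (@le_trans _ _ ('C(n, 2)%:R / 14 * (s2 / E))).
  have binE : 'C(n, 2)%:R = n%:R * (n%:R - 1) / 2 :> R.
    have : ('C(n, 2) * 2 = n * n.-1)%N by rewrite muln2 bin2 -[RHS]odd_double_half
      (_ : odd (n * n.-1) = false) // ?add0n //; case: (n) => // k; rewrite oddM /= andNb.
    move=> /(congr1 (fun k => k%:R : R)); rewrite !natrM => E2.
    have -> : n%:R - 1 = n.-1%:R :> R.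
      by rewrite -[in LHS](prednK (leq_trans (isT : 0 < 29)%N n29)) -natr1 addrK.
    by rewrite -E2 mulfK.
  rewrite binE.
  have : 0 <= s2 / E by rewrite divr_ge0 // ltW.
  set t := s2 / E => t0.
  have -> : (29 * E)^-1 * (n%:R ^+ 2 * s2) = (n%:R ^+ 2 / 29) * t.
    by rewrite /t; field; rewrite gt_eqF.
  rewrite ler_wpM2r //; nra.
rewrite ler_wpM2l ?divr_ge0 // mulr_suml; apply: ler_sum => x _.
by rewrite ler_wpM2l ?sqr_ge0.
Qed.

Lemma kolmogorov_distance_le (R : realType) (n : nat) (S : finType)
    (p : S -> R) (pmax gamma sigma : R) :
  is_pmf p -> (forall x, p x <= pmax) -> 0 <= pmax -> pmax <= 1 / 11 ->
  n%:R * pmax <= gamma -> 1 <= gamma -> (29 <= n)%N -> 2 <= sigma ->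
  sigma ^+ 2 = Ex p (fun z => @nonisolated R n S z ^+ 2)
               - Ex p (@nonisolated R n S) ^+ 2 ->
  kolmogorov_distance R n S p sigma <=
  1666 * (gamma * (29 * expR (21 / 10 * gamma)) / sigma).
Proof.
move=> pP p_le pm0 pm gm g1 n29 s2 sE.
have s0 : 0 < sigma by lra.
set K := 29 * _.
have K1 : 1 <= K.
  rewrite /K; have : 1 <= expR (21 / 10 * gamma).
    by rewrite -[leLHS]expR0 ler_expR mulr_ge0 //; lra.
  lra.
set a := n%:R ^+ 2 * \sum_x p x ^+ 2.
have a0 : 0 <= a by rewrite mulr_ge0 ?sqr_ge0 // sumr_ge0 // => x _; exact: sqr_ge0.
have aK : a <= K * sigma ^+ 2 by rewrite sE; exact: variance_nonisolated_ge.
set M := (Num.truncn (512 * K)).+1.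
have K512 : 0 <= 512 * K by lra.
have /andP[M1 M2] := truncn_itv K512.
have v0 : 0 <= 96 * (gamma * K * sigma) by rewrite !mulr_ge0 //; lra.
have D0 : 0 <= kolmogorov_distance R n S p sigma.
  exact: le_trans (normr_ge0 _) (distance_ub R n S p pP sigma 0).
apply: (@bootstrap R _ a sigma gamma K M) => //.
- exact: ltW.
- by rewrite /M -natr1 lerD2r.
apply: distance_upper_bound => //.
- exact: Ex_incr_prod_abs.
move=> psi psi_lip; apply: (le_trans (Var_qsum n pP p_le psi_lip)).
(* 96^2 = 2 * 4608, and the 2 absorbs 1 + n [pmax] <= 2 gamma. *)
have -> : (96 * (gamma * K * sigma)) ^+ 2 =
    4608 * (2 * (gamma * K * (gamma * K) * sigma ^+ 2)) by ring.
apply: ler_wpM2l; first by rewrite ler0n.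
apply: (@le_trans _ _ (K * sigma ^+ 2 * (2 * gamma))).
  apply: ler_pM => //; last by lra.
  by rewrite addr_ge0 // mulr_ge0.
have -> : K * sigma ^+ 2 * (2 * gamma) = 2 * (gamma * K * 1 * sigma ^+ 2) by ring.
rewrite ler_pM2l // ler_pM2r ?exprn_gt0 //; apply: ler_wpM2l.
  by rewrite mulr_ge0 //; lra.
by rewrite -[leLHS]mulr1; apply: ler_pM.
Qed.

Theorem theorem3 (R : realType) (d : measure_display) (T : measurableType d)
    (P : probability T R) (n m : nat) (hm : (4 <= m)%N)
    (p : 'I_m -> R) (p_gt0 : forall x, 0 < p x) (p_sum : \sum_(x < m) p x = 1)
    (X : 'I_n -> T -> 'I_m) (X_rv : forall i, discrete_rv (X i))
    (X_indep : mutually_independent P X)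
    (X_pmf : forall i x, P (X i @^-1` [set x]) = (p x)%:E) :
  let Y : T -> R := fun w => (num_nonisolated (X^~ w))%:R in
  let sigmaY : R := std_dev P Y in
  let DY : R := normal_distance P Y in
  let normp : R := sup (range p) in
  let gamma : R := Num.max (n%:R * normp) 1 in
  0 < sigmaY ->
  Num.min (1 / 6) ((Num.sqrt (8 * pi * expR 1))^-1 * sigmaY^-1) <= DY
  /\ (normp <= 1 / 11 ->
      83 * gamma ^+ 2 * (1 + 3 * gamma + 3 * gamma ^+ 2)
        * expR (105 / 100 * gamma) <= n%:R ->
      DY <= 8165 * gamma ^+ 2 * expR (21 / 10 * gamma)
              * (577 + 23 * Cgamma gamma) * sigmaY^-1).
Proof.
move=> Y sigmaY DY normp gamma sigma0.
have pP : is_pmf p by split=> // x; exact: ltW.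
pose F := @nonisolated R n 'I_m.
have YE w : Y w = F (sample _ _ _ _ X w) by exact: num_nonisolatedE.
have mean : fine 'E_P[Y]%E = Ex p F.
  have -> : Y = (fun w => F (sample _ _ _ _ X w)) by apply/funext.
  exact: (congr1 fine (expectation_sample R d T P n _ p X X_rv X_indep X_pmf F)).
have varE : sigmaY ^+ 2 = Ex p (fun z => F z ^+ 2) - Ex p F ^+ 2.
  have -> : sigmaY = Num.sqrt (Ex p (fun z => (F z - Ex p F) ^+ 2)).
    rewrite /sigmaY /std_dev /variance unlock.
    have -> : ((Y \- cst (fine 'E_P[Y]%E)) * (Y \- cst (fine 'E_P[Y]%E)))%R =
       (fun w => (fun z => (F z - Ex p F) ^+ 2) (sample _ _ _ _ X w)).
      by apply/funext => w; rewrite mean /= -YE expr2.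
    have := expectation_sample R d T P n _ p X X_rv X_indep X_pmf
      (fun z => (F z - Ex p F) ^+ 2).
    by move=> /= ->.
  rewrite sqr_sqrtr ?(Ex_sqr_dev pP) // -(Ex_sqr_dev pP).
  by apply: (Ex_ge0 pP) => z; exact: sqr_ge0.
have DE : DY = kolmogorov_distance R n 'I_m p sigmaY.
  rewrite /DY /normal_distance /kolmogorov_distance; congr (sup _).
  apply/seteqP; split => _ [t _ <-]; exists t => //; congr (`|_ - _|);
    rewrite mean -/sigmaY /std_cdf -(prob_sample_event R d T P n _ p X X_rv X_indep X_pmf);
    congr (fine (P _)); apply/funext => w /=; by rewrite YE.
have p_le x : p x <= normp.
  apply: ub_le_sup; last by exists x.
  by exists 1 => _ [y _ <-]; rewrite -p_sum (bigD1 y) //= lerDl sumr_ge0 // => *; exact: ltW.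
have normp0 : 0 <= normp.
  exact: le_trans (ltW (p_gt0 (Ordinal (leq_trans (isT : 0 < 4)%N hm)))) (p_le _).
have gamma1 : 1 <= gamma by rewrite le_max lexx orbT.
have ngamma : n%:R * normp <= gamma by rewrite le_max lexx.
have E1 (c : R) : 0 <= c -> 1 <= expR (c * gamma).
  by move=> c0; rewrite -[leLHS]expR0 ler_expR mulr_ge0 //; lra.
split; first by rewrite DE; exact: distance_ge.
move=> pm nE.
have gg : 1 <= gamma ^+ 2 by rewrite -[leLHS](expr1n R 2) lerXn2r ?nnegrE //; lra.
have e1 : 1 <= expR (105 / 100 * gamma) by apply: E1; lra.
have n83 : 83 <= n%:R :> R.
  apply: le_trans nE; rewrite -2![83 * _ * _]mulrA ler_peMr //.
  have q1 : 1 <= 1 + 3 * gamma + 3 * gamma ^+ 2 by lra.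
  by rewrite -mulrA -[leLHS]mulr1; apply: ler_pM => //; rewrite -[leLHS]mulr1; apply: ler_pM.
have n29 : (29 <= n)%N.
  by apply: leq_trans (_ : 83 <= n)%N; rewrite // -(ler_nat R).
have C0 : 0 <= Cgamma gamma by rewrite mulr_ge0 // sqrtr_ge0.
pose E := expR (21 / 10 * gamma).
have E0 : 1 <= E by apply: E1; lra.
have gE : gamma * E <= gamma ^+ 2 * E by rewrite ler_pM2r ?expr2 ?ler_peMl //; lra.
have gE1 : 1 <= gamma * E by rewrite -[leLHS]mulr1; apply: ler_pM.
(* The value 50000 exceeds 1666 * 29 = 48314, and for sigma < 2 it makes the right-hand side larger
   than the trivial bound 1. *)
have RHS_ge : 100 * 500 * (gamma * E / sigmaY) <=
    8165 * gamma ^+ 2 * expR (21 / 10 * gamma) * (577 + 23 * Cgamma gamma) * sigmaY^-1.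
  rewrite mulrA ler_pM2r ?invr_gt0 // -/E.
  have -> : 100 * 500 * (gamma * E) = 100 * (gamma * E) * 500 by ring.
  apply: ler_pM; rewrite ?ler0n //.
  - by apply: mulr_ge0; [rewrite ler0n|exact: le_trans gE1].
  - rewrite -mulrA; apply: ler_pM; rewrite ?ler0n ?ler_nat //.
    exact: le_trans gE1.
  - have : 500 <= 577 :> R by rewrite ler_nat.
    lra.
apply: le_trans RHS_ge.
have [s2|s2] := leP 2 sigmaY; last first.
  apply: (@le_trans _ _ 1).
    by rewrite DE; apply: distance_le => t; exact: distance_le1.
  rewrite mulrA ler_pdivlMr // mul1r; lra.
rewrite DE.
apply: le_trans (@kolmogorov_distance_le R n 'I_m p normp gamma sigmaY
  pP p_le normp0 pm ngamma gamma1 n29 s2 varE) _.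
have t0 : 0 <= gamma * E / sigmaY by apply: divr_ge0; [exact: le_trans gE1|exact: ltW].
rewrite -/E (_ : gamma * (29 * E) / sigmaY = 29 * (gamma * E / sigmaY)); last by ring.
lra.
Qed.
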